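(* For every Turing degree $d$ the following are equivalent: (i) $d\gg 0'$; (ii) for every computable bounded sequence of real numbers, $d$ computes an accumulation point of that sequence.
   Context: For Turing degrees $a,b$, write $a\gg b$ if every infinite $b$-computable 0/1-tree (a $b$-computable set of finite 0/1-sequences closed under initial segments) has an infinite branch computable in $a$. $0'$ is the degree of the halting problem. A computable sequence of reals is a sequence $(x_i)_{i\in\mathbb N}$ of uniformly computable real numbers (rational approximations to $x_i$ within $2^{-k}$ are computable from $i,k$). A degree $d$ computes a real $x$ if there is a $d$-computable sequence of rationals $(q_k)_k$ with $|q_k-x|\le 2^{-k}$ for all $k$. An accumulation point of $(x_i)$ is a real $x$ that is the limit of some subsequence of $(x_i)$. *)

(* Defs.v *)
From Stdlib Require Import Arith Cantor List Ensembles Finite_sets.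
From Stdlib Require Import ZArith QArith Qreals Reals.
Import ListNotations.
Set Implicit Arguments.
Open Scope nat_scope.

Notation "⟨ a , b ⟩" := (Cantor.to_nat (a, b)) (at level 0, a, b at level 99).

(** Programs for the unary partial functions on [nat] that are recursive in an
    oracle; functions of several arguments are coded with the Cantor pairing. *)

Inductive code : Type :=
| Zero | Succ | Fst | Snd | Oracle
| Pair (c1 c2 : code)
| Comp (c1 c2 : code)
| Prec (c1 c2 : code)
| Mu (c : code).

(** [eval A c n v]: with (the characteristic function of) the set [A] as
    oracle, program [c] halts on input [n] with output [v]. *)
Inductive eval (A : nat -> Prop) : code -> nat -> nat -> Prop :=
| eval_Zero n : eval A Zero n 0
| eval_Succ n : eval A Succ n (S n)
| eval_Fst a b : eval A Fst ⟨a, b⟩ a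
| eval_Snd a b : eval A Snd ⟨a, b⟩ b
| eval_Oracle_in n : A n -> eval A Oracle n 1
| eval_Oracle_out n : ~ A n -> eval A Oracle n 0
| eval_Pair c1 c2 n v1 v2 :
    eval A c1 n v1 -> eval A c2 n v2 -> eval A (Pair c1 c2) n ⟨v1, v2⟩
| eval_Comp c1 c2 n u v :
    eval A c2 n u -> eval A c1 u v -> eval A (Comp c1 c2) n v
| eval_Prec_0 c1 c2 a v :
    eval A c1 a v -> eval A (Prec c1 c2) ⟨a, 0⟩ v
| eval_Prec_S c1 c2 a k u v :
    eval A (Prec c1 c2) ⟨a, k⟩ u ->
    eval A c2 ⟨a, ⟨k, u⟩⟩ v ->
    eval A (Prec c1 c2) ⟨a, S k⟩ v
| eval_Mu c a n (w : nat -> nat) :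
    (forall m, m < n -> eval A c ⟨a, m⟩ (S (w m))) ->
    eval A c ⟨a, n⟩ 0 ->
    eval A (Mu c) a n.

(** A Gödel numbering; it is a bijection between [code] and [nat]. *)
Fixpoint encode (c : code) : nat :=
  match c with
  | Zero => 0
  | Succ => 1
  | Fst => 2
  | Snd => 3
  | Oracle => 4
  | Pair c1 c2 => 5 + 4 * ⟨encode c1, encode c2⟩
  | Comp c1 c2 => 6 + 4 * ⟨encode c1, encode c2⟩
  | Prec c1 c2 => 7 + 4 * ⟨encode c1, encode c2⟩
  | Mu c1 => 8 + 4 * encode c1
  end.

Definition computable_in (A : nat -> Prop) (f : nat -> nat) : Prop :=
  exists c, forall n, eval A c n (f n).

Definition empty_oracle : nat -> Prop := fun _ => False.

Definition computable (f : nat -> nat) : Prop := computable_in empty_oracle f.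

Definition turing_le (B A : nat -> Prop) : Prop :=
  exists c, forall n, (B n -> eval A c n 1) /\ (~ B n -> eval A c n 0).

Definition turing_equiv (A B : nat -> Prop) : Prop :=
  turing_le A B /\ turing_le B A.

Definition halting_problem (m : nat) : Prop :=
  exists c n v, m = ⟨encode c, n⟩ /\ eval empty_oracle c n v.

(** A degree is an equivalence class of sets of natural numbers. *)
Record degree : Type := Degree {
  members :> (nat -> Prop) -> Prop;
  members_class : exists A, forall B, members B <-> turing_equiv B A
}.

Definition degree_of (A : nat -> Prop) : degree :=
  Degree (fun B => turing_equiv B A)
    (ex_intro _ A (fun B => iff_refl (turing_equiv B A))).

Definition zero_jump : degree := degree_of halting_problem.

Definition degree_computes (d : degree) (f : nat -> nat) : Prop :=
  exists A, d A /\ computable_in A f.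

Definition degree_decides (d : degree) (B : nat -> Prop) : Prop :=
  exists A, d A /\ turing_le B A.

(** A bijection between finite 0/1-sequences and [nat]. *)
Fixpoint code_word (s : list bool) : nat :=
  match s with
  | [] => 0
  | b :: s' => 1 + Nat.b2n b + 2 * code_word s'
  end.

Definition is_tree (T : list bool -> Prop) : Prop :=
  forall s t, T (s ++ t) -> T s.

Definition computable_tree_in (d : degree) (T : list bool -> Prop) : Prop :=
  is_tree T /\ degree_decides d (fun n => exists s, T s /\ n = code_word s).

Definition is_branch (T : list bool -> Prop) (p : nat -> bool) : Prop :=
  forall n, T (map p (seq 0 n)).

(** The relation a ≫ b. *)
Definition degree_gg (a b : degree) : Prop :=
  forall T : list bool -> Prop,
    computable_tree_in b T -> ~ Finite (list bool) T ->
    exists p : nat -> bool,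
      is_branch T p /\ degree_computes a (fun n => Nat.b2n (p n)).

Definition code_Z (z : Z) : nat :=
  match z with
  | Z0 => 0
  | Zpos p => 2 * Pos.to_nat p
  | Zneg p => 2 * Pos.to_nat p - 1
  end.

(** Fractions need not be reduced; the sequences of rational values having a
    computable sequence of representatives are the same either way. *)
Definition code_Q (q : Q) : nat := ⟨code_Z (Qnum q), Pos.to_nat (Qden q)⟩.

Definition degree_computes_real (d : degree) (x : R) : Prop :=
  exists q : nat -> Q,
    degree_computes d (fun k => code_Q (q k)) /\
    forall k, (Rabs (Q2R (q k) - x) <= (/ 2) ^ k)%R.

Definition computable_real_sequence (x : nat -> R) : Prop :=
  exists q : nat -> nat -> Q,
    computable (fun m => let (i, k) := Cantor.of_nat m in code_Q (q i k)) /\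
    forall i k, (Rabs (Q2R (q i k) - x i) <= (/ 2) ^ k)%R.

Definition bounded_sequence (x : nat -> R) : Prop :=
  exists M : R, forall i, (Rabs (x i) <= M)%R.

Definition accumulation_point (x : nat -> R) (a : R) : Prop :=
  exists phi : nat -> nat,
    (forall m n, m < n -> phi m < phi n) /\ Un_cv (fun n => x (phi n)) a.

(* Main.v *)
(** For a computable sequence with rational approximations [r_i], the words [s]
    whose dyadic interval contains some [r_i] with [i >= |s|] form an infinite
    tree that is computably enumerable, hence decidable in [0']; a branch of it
    is a binary expansion of an accumulation point.

    Conversely, an infinite [0']-computable tree is a pointwise limit of
    uniformly computable sets [T_s]. Let [w_s] be the longest word up to [s] all
    of whose prefixes lie in [T_s]. For every [n], the prefix of [w_s] of length
    [n] exists and lies in the tree when [s] is large, so all accumulation points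
    of [w_s] in Cantor space are branches. Embedding Cantor space into the reals
    by base-4 expansions with digits 0 and 1 turns the [w_s] into a computable
    sequence of reals, and an accumulation point computes its digits. *)

From Stdlib Require Import Arith Cantor List Ensembles Finite_sets.
From Stdlib Require Import ZArith QArith Qreals Reals Lra Lia.
From Stdlib Require Import Classical ClassicalEpsilon.
From Stdlib Require Import FunctionalExtensionality PropExtensionality.
Require Import Defs.
Import ListNotations.
Open Scope nat_scope.

(** * Projections of the Cantor pairing *)

Notation "'π1' n" := (fst (Cantor.of_nat n)) (at level 9, n at level 9).
Notation "'π2' n" := (snd (Cantor.of_nat n)) (at level 9, n at level 9).

Lemma pair_eta n : ⟨π1 n, π2 n⟩ = n.
Proof. rewrite <- surjective_pairing. apply Cantor.cancel_to_of. Qed.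

Lemma pi1_pair a b : π1 ⟨a, b⟩ = a.
Proof. now rewrite Cantor.cancel_of_to. Qed.

Lemma pi2_pair a b : π2 ⟨a, b⟩ = b.
Proof. now rewrite Cantor.cancel_of_to. Qed.

Lemma pair_inj a b a' b' : ⟨a, b⟩ = ⟨a', b'⟩ -> a = a' /\ b = b'.
Proof.
  intros H. split.
  - now rewrite <- (pi1_pair a b), H, pi1_pair.
  - now rewrite <- (pi2_pair a b), H, pi2_pair.
Qed.

Lemma le_pair a b : a <= ⟨a, b⟩ /\ b <= ⟨a, b⟩.
Proof. pose proof (Cantor.to_nat_non_decreasing a b). lia. Qed.

(** * Closure properties of relative computability *)

(** Classical: every predicate has a characteristic function, and whether it is computable is a
    separate matter, see [dec_char]. *)
Definition char (P : nat -> Prop) (n : nat) : nat :=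
  if excluded_middle_informative (P n) then 1 else 0.

Lemma char_true (P : nat -> Prop) n : P n -> char P n = 1.
Proof. unfold char. now destruct (excluded_middle_informative (P n)). Qed.

Lemma char_false (P : nat -> Prop) n : ~ P n -> char P n = 0.
Proof. unfold char. now destruct (excluded_middle_informative (P n)). Qed.

Section Closure.
Variable A : nat -> Prop.

Notation rec f := (computable_in A f).
Notation dec P := (turing_le P A).

Lemma rec_ext f g : (forall n, f n = g n) -> rec f -> rec g.
Proof. intros E [c H]. exists c. intros n. rewrite <- E. apply H. Qed.

Lemma rec_comp f g : rec f -> rec g -> rec (fun z => f (g z)).
Proof.
  intros [c H] [c' H']. exists (Comp c c'). intros n. eapply eval_Comp; eauto.
Qed.

Lemma rec_pi1 f : rec f -> rec (fun z => π1 (f z)).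
Proof.
  intros H. apply (rec_comp (fun z => π1 z)); [|exact H].
  exists Fst. intros n. rewrite <- (pair_eta n) at 1. constructor.
Qed.

Lemma rec_pi2 f : rec f -> rec (fun z => π2 (f z)).
Proof.
  intros H. apply (rec_comp (fun z => π2 z)); [|exact H].
  exists Snd. intros n. rewrite <- (pair_eta n) at 1. constructor.
Qed.

Lemma rec_pair f g : rec f -> rec g -> rec (fun z => ⟨f z, g z⟩).
Proof.
  intros [c H] [c' H']. exists (Pair c c'). intros n. now constructor.
Qed.

Lemma rec_id : rec (fun z => z).
Proof.
  exists (Pair Fst Snd). intros n. rewrite <- (pair_eta n). repeat constructor.
Qed.

Lemma rec_S f : rec f -> rec (fun z => S (f z)).
Proof. apply (rec_comp S). exists Succ. constructor. Qed.

Lemma rec_const k : rec (fun _ => k).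
Proof.
  induction k; [|now apply rec_S]. exists Zero. constructor.
Qed.

Lemma rec_comp2 (f : nat -> nat -> nat) g h :
  rec (fun w => f (π1 w) (π2 w)) -> rec g -> rec h -> rec (fun z => f (g z) (h z)).
Proof.
  intros H Hg Hh.
  apply rec_ext with (fun z => f (π1 ⟨g z, h z⟩) (π2 ⟨g z, h z⟩)).
  - intros n. now rewrite pi1_pair, pi2_pair.
  - apply (rec_comp (fun w => f (π1 w) (π2 w))); [exact H|]. now apply rec_pair.
Qed.

Lemma rec_prec f (g : nat -> nat -> nat -> nat) n :
  rec f -> rec (fun w => g (π1 w) (π1 (π2 w)) (π2 (π2 w))) -> rec n ->
  rec (fun z => nat_rect (fun _ => nat) (f z) (g z) (n z)).
Proof.
  intros [c Hf] [c' Hg]. apply (rec_comp2 (fun z n => nat_rect (fun _ => nat) (f z) (g z) n)).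
  2: apply rec_id.
  exists (Prec c c'). intros w. rewrite <- (pair_eta w) at 1.
  induction (π2 w) as [|k IH]; simpl.
  - now constructor.
  - econstructor; [exact IH|].
    match goal with |- eval _ _ ?x _ => specialize (Hg x) end.
    now rewrite !pi2_pair, !pi1_pair in Hg.
Qed.

Lemma rec_add f g : rec f -> rec g -> rec (fun z => f z + g z).
Proof.
  intros Hf Hg.
  apply rec_ext with (fun z => nat_rect (fun _ => nat) (f z) (fun _ u => S u) (g z)).
  - intros z. induction (g z); simpl; lia.
  - apply rec_prec; auto. apply rec_S, rec_pi2, rec_pi2, rec_id.
Qed.

Lemma rec_mul f g : rec f -> rec g -> rec (fun z => f z * g z).
Proof.
  intros Hf Hg.
  apply rec_ext with (fun z => nat_rect (fun _ => nat) 0 (fun _ u => u + f z) (g z)).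
  - intros z. induction (g z); simpl; lia.
  - apply (rec_prec (fun _ => 0) (fun z _ u => u + f z)); auto using rec_const.
    apply rec_add; [apply rec_pi2, rec_pi2, rec_id|].
    apply (rec_comp f); auto using rec_pi1, rec_id.
Qed.

Lemma rec_pow f g : rec f -> rec g -> rec (fun z => f z ^ g z).
Proof.
  intros Hf Hg.
  apply rec_ext with (fun z => nat_rect (fun _ => nat) 1 (fun _ u => u * f z) (g z)).
  - intros z. induction (g z); simpl; lia.
  - apply (rec_prec (fun _ => 1) (fun z _ u => u * f z)); auto using rec_const.
    apply rec_mul; [apply rec_pi2, rec_pi2, rec_id|].
    apply (rec_comp f); auto using rec_pi1, rec_id.
Qed.

Lemma rec_pred f : rec f -> rec (fun z => pred (f z)).
Proof.
  intros Hf.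
  apply rec_ext with (fun z => nat_rect (fun _ => nat) 0 (fun k _ => k) (f z)).
  - intros z. now destruct (f z).
  - apply (rec_prec (fun _ => 0) (fun _ k _ => k)); auto using rec_const.
    apply rec_pi1, rec_pi2, rec_id.
Qed.

Lemma rec_sub f g : rec f -> rec g -> rec (fun z => f z - g z).
Proof.
  intros Hf Hg.
  apply rec_ext with (fun z => nat_rect (fun _ => nat) (f z) (fun _ u => pred u) (g z)).
  - intros z. induction (g z); simpl; lia.
  - apply rec_prec; auto. apply rec_pred, rec_pi2, rec_pi2, rec_id.
Qed.

Lemma dec_char P : dec P <-> rec (char P).
Proof.
  split; intros [c H]; exists c; intros n; specialize (H n).
  - unfold char. destruct (excluded_middle_informative (P n)); tauto.
  - split; intros Hn; [rewrite char_true in H|rewrite char_false in H]; auto.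
Qed.

Lemma dec_iff P Q : (forall n, P n <-> Q n) -> dec P -> dec Q.
Proof.
  intros E [c H]. exists c. intros n. rewrite <- E. apply H.
Qed.

Lemma dec_rec P f : (forall n, P n <-> f n <> 0) -> rec f -> dec P.
Proof.
  intros E H. apply dec_char.
  (* Two truncated subtractions turn every nonzero value into 1. *)
  apply rec_ext with (fun z => 1 - (1 - f z)).
  - intros n. destruct (classic (P n)) as [Hn|Hn].
    + rewrite char_true by assumption. apply E in Hn. lia.
    + rewrite char_false by assumption. rewrite E in Hn. lia.
  - auto using rec_sub, rec_const.
Qed.

Lemma dec_comp P f : dec P -> rec f -> dec (fun z => P (f z)).
Proof.
  intros H Hf. apply dec_char in H. apply dec_char.
  exact (rec_comp _ _ H Hf).
Qed.

Lemma dec_not P : dec P -> dec (fun z => ~ P z).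
Proof.
  intros H. apply dec_char in H. apply dec_rec with (fun z => 1 - char P z).
  - intros n. destruct (classic (P n));
      [rewrite char_true by assumption|rewrite char_false by assumption]; intuition lia.
  - auto using rec_sub, rec_const.
Qed.

Lemma dec_and P Q : dec P -> dec Q -> dec (fun z => P z /\ Q z).
Proof.
  intros H H'. apply dec_char in H, H'. apply dec_rec with (fun z => char P z * char Q z).
  - intros n. unfold char.
    destruct (excluded_middle_informative (P n)), (excluded_middle_informative (Q n));
      intuition lia.
  - auto using rec_mul.
Qed.

Lemma dec_or P Q : dec P -> dec Q -> dec (fun z => P z \/ Q z).
Proof.
  intros H H'. apply dec_iff with (fun z => ~ (~ P z /\ ~ Q z)).
  - intros n. tauto.
  - auto using dec_not, dec_and.
Qed.

Lemma dec_imp P Q : dec P -> dec Q -> dec (fun z => P z -> Q z).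
Proof.
  intros H H'. apply dec_iff with (fun z => ~ P z \/ Q z).
  - intros n. tauto.
  - auto using dec_not, dec_or.
Qed.

Lemma dec_le f g : rec f -> rec g -> dec (fun z => f z <= g z).
Proof.
  intros Hf Hg. apply dec_rec with (fun z => S (g z) - f z); [lia|].
  auto using rec_sub, rec_S.
Qed.

Lemma dec_lt f g : rec f -> rec g -> dec (fun z => f z < g z).
Proof. intros Hf Hg. apply dec_le; auto using rec_S. Qed.

Lemma dec_eq f g : rec f -> rec g -> dec (fun z => f z = g z).
Proof.
  intros Hf Hg. apply dec_iff with (fun z => f z <= g z /\ g z <= f z); [lia|].
  auto using dec_and, dec_le.
Qed.

(** The bounded quantifier is a product of characteristic values, accumulated by primitive
    recursion. *)
Lemma dec_forall_lt (P : nat -> nat -> Prop) f :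
  rec f -> dec (fun w => P (π1 w) (π2 w)) ->
  dec (fun z => forall m, m < f z -> P z m).
Proof.
  intros Hf H. apply dec_char in H.
  set (C := char (fun w => P (π1 w) (π2 w))) in *.
  apply dec_rec with (fun z => nat_rect (fun _ => nat) 1 (fun k u => u * C ⟨z, k⟩) (f z)).
  - intros z. induction (f z) as [|k IH]; simpl.
    + split; [lia|]. intros _ m Hm. lia.
    + rewrite Nat.eq_mul_0. assert (E : C ⟨z, k⟩ <> 0 <-> P z k).
      { unfold C, char. rewrite pi1_pair, pi2_pair.
        destruct excluded_middle_informative; intuition lia. }
      assert (E' : (forall m, m < S k -> P z m) <-> (forall m, m < k -> P z m) /\ P z k).
      { split; [auto|]. intros [H1 H2] m Hm.
        destruct (Nat.eq_dec m k) as [->|]; [exact H2|]. apply H1; lia. }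
      rewrite E'. tauto.
  - apply (rec_prec (fun _ => 1) (fun z k u => u * C ⟨z, k⟩)); auto using rec_const.
    apply rec_mul; [apply rec_pi2, rec_pi2, rec_id|].
    apply (rec_comp C); auto. apply rec_pair; [|apply rec_pi1, rec_pi2, rec_id].
    apply rec_pi1, rec_id.
Qed.

Lemma dec_exists_lt (P : nat -> nat -> Prop) f :
  rec f -> dec (fun w => P (π1 w) (π2 w)) ->
  dec (fun z => exists m, m < f z /\ P z m).
Proof.
  intros Hf H. apply dec_iff with (fun z => ~ forall m, m < f z -> ~ P z m).
  - intros z. split.
    + intros N. apply not_all_ex_not in N as [m N]. exists m. tauto.
    + intros (m & Hm & Hp) N. exact (N m Hm Hp).
  - apply dec_not, (dec_forall_lt (fun z m => ~ P z m)); auto using dec_not.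
Qed.

Lemma rec_least (P : nat -> nat -> Prop) :
  dec (fun w => P (π1 w) (π2 w)) -> (forall z, exists n, P z n) ->
  exists f, rec f /\ forall z, P z (f z) /\ forall m, m < f z -> ~ P z m.
Proof.
  intros H Hex.
  assert (L : forall z, exists n, P z n /\ forall m, m < n -> ~ P z m).
  { intros z. destruct (Hex z) as [n Hn].
    destruct (dec_inh_nat_subset_has_unique_least_element (P z)) as [x [[? Hx] _]].
    - intros; apply classic.
    - now exists n.
    - exists x. split; auto. intros m Hm Hp. apply Hx in Hp. lia. }
  exists (fun z => proj1_sig (constructive_indefinite_description _ (L z))).
  split; [|intros z; now destruct constructive_indefinite_description].
  (* [Mu] stops at output 0, so it runs a program for the negation; the earlier outputs are 1, that
     is [S 0]. *)
  destruct (dec_not _ H) as [c Hc]. exists (Mu c). intros z.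
  destruct constructive_indefinite_description as [n [Hn Hm]]. simpl.
  apply eval_Mu with (w := fun _ => 0).
  - intros m Hmn. apply Hc. rewrite pi1_pair, pi2_pair. auto.
  - apply Hc. now rewrite pi1_pair, pi2_pair.
Qed.

(** Search finds the value once the graph is decidable. This yields division and logarithm, whose
    graphs are given by inequalities. *)
Lemma rec_graph f : dec (fun w => π2 w = f (π1 w)) -> rec f.
Proof.
  intros H. destruct (rec_least (fun z n => n = f z)) as (g & Hg & E); eauto.
  apply rec_ext with g; [|exact Hg]. intros z. apply E.
Qed.

Lemma rec_div f g : rec f -> rec g -> rec (fun z => f z / g z).
Proof.
  apply (rec_comp2 Nat.div). apply rec_graph.
  (* The first disjunct is the convention that division by 0 gives 0. *)
  apply dec_iff with (fun w => (π2 (π1 w) = 0 /\ π2 w = 0) \/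
    (π2 (π1 w) > 0 /\ π2 w * π2 (π1 w) <= π1 (π1 w) /\ π1 (π1 w) < S (π2 w) * π2 (π1 w))).
  - intros w. generalize (π2 w) (π1 (π1 w)) (π2 (π1 w)). intros q a b.
    split.
    + intros [[-> ->]|(Hb & H1 & H2)]; [reflexivity|].
      apply (Nat.div_unique a b q (a - q * b)); nia.
    + intros ->. destruct (Nat.eq_dec b 0) as [->|Hb]; [left; auto|right].
      pose proof (Nat.div_mod a b Hb). pose proof (Nat.mod_upper_bound a b Hb). nia.
  - repeat first [apply dec_or | apply dec_and | apply dec_eq | apply dec_le | apply dec_lt
      | apply rec_const | apply rec_id | apply rec_mul | apply rec_S
      | apply rec_pi1 | apply rec_pi2].
Qed.

Lemma rec_mod f g : rec f -> rec g -> rec (fun z => f z mod g z).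
Proof.
  intros Hf Hg. apply rec_ext with (fun z => f z - g z * (f z / g z)).
  - intros z. pose proof (Nat.div_mod_eq (f z) (g z)). lia.
  - auto using rec_sub, rec_mul, rec_div.
Qed.

Lemma rec_log2 f : rec f -> rec (fun z => Nat.log2 (f z)).
Proof.
  apply (rec_comp Nat.log2). apply rec_graph.
  apply dec_iff with (fun w => (π1 w = 0 /\ π2 w = 0) \/
    (0 < π1 w /\ 2 ^ π2 w <= π1 w /\ π1 w < 2 ^ S (π2 w))).
  - intros w. generalize (π1 w) (π2 w). intros a n. split.
    + intros [[-> ->]|(Ha & H1 & H2)]; [reflexivity|].
      symmetry. apply Nat.log2_unique; lia.
    + intros ->. destruct a as [|a]; [left; auto|right].
      pose proof (Nat.log2_spec (S a)). lia.
  - repeat first [apply dec_or | apply dec_and | apply dec_eq | apply dec_le | apply dec_lt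
      | apply rec_const | apply rec_id | apply rec_pow | apply rec_S
      | apply rec_pi1 | apply rec_pi2].
Qed.

Lemma rec_testbit f g :
  rec f -> rec g -> rec (fun z => Nat.b2n (Nat.testbit (f z) (g z))).
Proof.
  intros Hf Hg. apply rec_ext with (fun z => (f z / 2 ^ g z) mod 2).
  - intros z. now rewrite Nat.testbit_spec'.
  - auto using rec_mod, rec_div, rec_pow, rec_const.
Qed.

Lemma dec_testbit f g :
  rec f -> rec g -> dec (fun z => Nat.testbit (f z) (g z) = true).
Proof.
  intros Hf Hg. apply dec_rec with (fun z => Nat.b2n (Nat.testbit (f z) (g z))).
  - intros z. destruct (Nat.testbit _ _); simpl; intuition lia.
  - now apply rec_testbit.
Qed.

Lemma dec_oracle f : rec f -> dec (fun z => A (f z)).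
Proof. apply dec_comp. exists Oracle. split; now constructor. Qed.

End Closure.

(** Syntax-directed descent through arithmetic terms and formulas with bounded quantifiers. Curried
    functions are left over, to be handled with [rec_comp2]. *)
Ltac rec_step := cbv beta;
  first
  [ assumption
  | apply rec_id | apply rec_const | apply rec_div | apply rec_mod
  | apply rec_pi1 | apply rec_pi2 | apply rec_pair
  | apply rec_S | apply rec_add | apply rec_mul | apply rec_pow | apply rec_sub
  | apply rec_log2 | apply rec_testbit
  | apply dec_forall_lt | apply dec_exists_lt
  | apply dec_not | apply dec_and | apply dec_or | apply dec_imp
  | apply dec_lt | apply dec_le | apply dec_eq | apply dec_testbit
  | match goal with
    | H : computable_in _ ?f |- computable_in _ (fun z => ?f _) => apply (rec_comp _ f)
    | H : computable ?f |- computable_in _ (fun z => ?f _) => apply (rec_comp _ f)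
    end ].
Ltac rec_tac := repeat rec_step.

(** * Words and digits *)

(** Horner's scheme with [p 0] as the most significant digit, so that longer initial segments refine
    the number, as in expansions of reals. *)
Definition digits (b : nat) (p : nat -> nat) (n : nat) : nat :=
  nat_rect (fun _ => nat) 0 (fun k u => b * u + p k) n.

Definition word (p : nat -> bool) (n : nat) : nat := code_word (map p (seq 0 n)).

(* In binary, [S (code_word s)] is a leading 1 followed by the letters of [s],
   the first letter of [s] being the least significant digit. *)
Definition len (w : nat) : nat := Nat.log2 (S w).
Definition bits (w : nat) : nat -> bool := Nat.testbit (S w).

Lemma digits_S b p n : digits b p (S n) = b * digits b p n + p n.
Proof. reflexivity. Qed.

Lemma digits_ext b p p' n :
  (forall k, k < n -> p k = p' k) -> digits b p n = digits b p' n.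
Proof.
  induction n as [|n IH]; intros H; [reflexivity|].
  rewrite !digits_S, IH, H; auto.
Qed.

Lemma digits_lower b p m n : digits b p m * b ^ n <= digits b p (m + n).
Proof.
  induction n as [|n IH].
  - rewrite Nat.add_0_r. simpl. lia.
  - rewrite (Nat.add_succ_r m n), digits_S. simpl. nia.
Qed.

(** Later digits add at most the geometric sum [(S b ^ n - 1) / b]; multiplying by [b] avoids the
    division. The bases in use are 2 and 4. *)
Lemma digits_upper b p m n :
  (forall k, p k <= 1) ->
  b * digits (S b) p (m + n) + 1 <= (b * digits (S b) p m + 1) * S b ^ n.
Proof.
  intros H. induction n as [|n IH].
  - rewrite Nat.add_0_r. simpl. lia.
  - rewrite (Nat.add_succ_r m n), digits_S, Nat.pow_succ_r'. specialize (H (m + n)). nia.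
Qed.

Lemma code_word_snoc s b :
  code_word (s ++ [b]) = code_word s + 2 ^ length s * S (Nat.b2n b).
Proof.
  induction s as [|b' s IH]; simpl; [lia|]. rewrite IH. simpl. lia.
Qed.

Lemma word_S p n : word p (S n) = word p n + 2 ^ n * S (Nat.b2n (p n)).
Proof.
  unfold word. rewrite seq_S, map_app. simpl.
  now rewrite code_word_snoc, length_map, length_seq.
Qed.

Lemma S_code_word_cons b s :
  S (code_word (b :: s)) = 2 * S (code_word s) + Nat.b2n b.
Proof. simpl. lia. Qed.

Lemma len_code_word s : len (code_word s) = length s.
Proof.
  unfold len. induction s as [|b s IH]; [reflexivity|].
  rewrite S_code_word_cons. cbn [length]. rewrite <- IH.
  destruct b; cbn [Nat.b2n].
  - apply Nat.log2_succ_double. lia.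
  - rewrite Nat.add_0_r. apply Nat.log2_double. lia.
Qed.

Lemma bits_code_word s i : i < length s -> bits (code_word s) i = nth i s false.
Proof.
  unfold bits. revert i. induction s as [|b s IH]; intros i Hi; simpl in Hi; [lia|].
  rewrite S_code_word_cons. destruct i as [|i].
  - now rewrite Nat.testbit_0_r.
  - rewrite Nat.testbit_succ_r. apply IH. lia.
Qed.

Lemma code_word_bits s : map (bits (code_word s)) (seq 0 (length s)) = s.
Proof.
  apply nth_ext with (d := bits (code_word s) 0) (d' := false).
  - now rewrite length_map, length_seq.
  - intros i Hi. rewrite length_map, length_seq in Hi.
    rewrite map_nth, seq_nth by assumption. now apply bits_code_word.
Qed.

Lemma code_word_inj s t : code_word s = code_word t -> s = t.
Proof.
  intros E. rewrite <- (code_word_bits s), <- (code_word_bits t).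
  rewrite <- !len_code_word. now rewrite E.
Qed.

Lemma code_word_surj w : exists s, w = code_word s.
Proof.
  induction w as [w IH] using (well_founded_induction lt_wf).
  destruct w as [|w]; [now exists []|].
  destruct (IH (w / 2)) as [s Hs].
  - pose proof (Nat.div_mod_eq w 2). lia.
  - exists (Nat.odd w :: s). cbn [code_word]. rewrite <- Hs.
    rewrite <- Nat.bit0_odd, Nat.bit0_mod.
    pose proof (Nat.div_mod_eq w 2). lia.
Qed.

Lemma len_word p n : len (word p n) = n.
Proof. unfold word. now rewrite len_code_word, length_map, length_seq. Qed.

Lemma bits_word p n i : i < n -> bits (word p n) i = p i.
Proof.
  intros Hi. unfold word.
  rewrite bits_code_word by (now rewrite length_map, length_seq).
  rewrite nth_indep with (d' := p 0) by (now rewrite length_map, length_seq).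
  rewrite map_nth. now rewrite seq_nth.
Qed.

Lemma word_lt p n : word p n < 2 ^ S n.
Proof.
  induction n as [|n IH]; [cbn; lia|].
  rewrite word_S. rewrite !Nat.pow_succ_r' in *. destruct (p n); cbn [Nat.b2n]; lia.
Qed.

Lemma rec_digits A b (p : nat -> nat -> nat) n :
  computable_in A (fun w => p (π1 w) (π2 w)) -> computable_in A n ->
  computable_in A (fun z => digits b (p z) (n z)).
Proof.
  intros Hp Hn. apply (rec_prec _ (fun _ => 0) (fun z k u => b * u + p z k)); rec_tac.
  apply (rec_comp2 _ p); rec_tac.
Qed.

Lemma rec_word A (p : nat -> nat -> bool) n :
  computable_in A (fun w => Nat.b2n (p (π1 w) (π2 w))) -> computable_in A n ->
  computable_in A (fun z => word (p z) (n z)).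
Proof.
  intros Hp Hn.
  apply rec_ext with (fun z => nat_rect (fun _ => nat) 0
    (fun k u => u + 2 ^ k * S (Nat.b2n (p z k))) (n z)).
  - intros z. induction (n z) as [|k IH]; [reflexivity|].
    rewrite word_S, <- IH. reflexivity.
  - apply (rec_prec _ (fun _ => 0) (fun z k u => u + 2 ^ k * S (Nat.b2n (p z k)))); rec_tac.
    apply (rec_comp2 _ (fun z k => Nat.b2n (p z k))); rec_tac.
Qed.

(** * The limit lemma *)

Definition eventually (P : nat -> Prop) : Prop := exists s0, forall s, s0 <= s -> P s.

Lemma eventually_and P Q :
  eventually P -> eventually Q -> eventually (fun s => P s /\ Q s).
Proof.
  intros [s H] [s' H']. exists (max s s'). intros t Ht.
  split; [apply H|apply H']; lia.
Qed.

Lemma eventually_mono (P Q : nat -> Prop) :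
  (forall s, P s -> Q s) -> eventually P -> eventually Q.
Proof. intros E [s H]. exists s. auto. Qed.

Lemma eventually_forall_lt (P : nat -> nat -> Prop) n :
  (forall m, m < n -> eventually (P m)) ->
  eventually (fun s => forall m, m < n -> P m s).
Proof.
  induction n as [|n IH]; intros H; [exists 0; lia|].
  assert (IH' : eventually (fun s => forall m, m < n -> P m s)) by auto.
  assert (Hn : eventually (P n)) by auto.
  refine (eventually_mono _ _ _ (eventually_and _ _ IH' Hn)).
  intros s [H1 H2] m Hm. destruct (Nat.eq_dec m n) as [->|]; auto. apply H1; lia.
Qed.

Lemma eventually_ge n : eventually (fun s => n <= s).
Proof. now exists n. Qed.

Definition approximable (B : nat -> Prop) : Prop :=
  exists f : nat -> nat -> nat,
    computable (fun w => f (π1 w) (π2 w)) /\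
    forall n, eventually (fun s => f s n = char B n).

(* The program is interpreted at stage [s] with the [s]-th approximation of the
   oracle, the unbounded searches being cut off at [s]; hence the interpretation
   is total, and no universal program is needed. *)
Lemma eval_approximable A c :
  approximable A ->
  exists f : nat -> nat -> nat,
    computable (fun w => f (π1 w) (π2 w)) /\
    forall n v, eval A c n v -> eventually (fun s => f s n = v).
Proof.
  intros (fA & HfA & LA).
  induction c as [| | | | |c1 (f1 & H1 & L1) c2 (f2 & H2 & L2)
    |c1 (f1 & H1 & L1) c2 (f2 & H2 & L2)|c1 (f1 & H1 & L1) c2 (f2 & H2 & L2)
    |c1 (f1 & H1 & L1)].
  - exists (fun _ _ => 0). split; [unfold computable; rec_tac|].
    intros n v E. inversion E. now exists 0.
  - exists (fun _ n => S n). split; [unfold computable; rec_tac|].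
    intros n v E. inversion E. now exists 0.
  - exists (fun _ n => π1 n). split; [unfold computable; rec_tac|].
    intros n v E. inversion E. exists 0. intros. apply pi1_pair.
  - exists (fun _ n => π2 n). split; [unfold computable; rec_tac|].
    intros n v E. inversion E. exists 0. intros. apply pi2_pair.
  - exists fA. split; [exact HfA|]. intros n v E.
    inversion E; subst; [rewrite <- (char_true A n)|rewrite <- (char_false A n)]; auto.
  - exists (fun s n => ⟨f1 s n, f2 s n⟩). split; [unfold computable; rec_tac|].
    intros n v E. inversion E; subst.
    match goal with H1 : eval A c1 _ _, H2 : eval A c2 _ _ |- _ =>
      refine (eventually_mono _ _ _ (eventually_and _ _ (L1 _ _ H1) (L2 _ _ H2))) end.
    intros s [-> ->]. reflexivity.
  - exists (fun s n => f1 s (f2 s n)). split.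
    { apply (rec_comp2 _ f1); rec_tac. }
    intros n v E. inversion E; subst.
    match goal with H1 : eval A c1 _ _, H2 : eval A c2 _ _ |- _ =>
      refine (eventually_mono _ _ _ (eventually_and _ _ (L2 _ _ H2) (L1 _ _ H1))) end.
    intros s [-> ->]. reflexivity.
  - exists (fun s n => nat_rect (fun _ => nat) (f1 s (π1 n))
      (fun k u => f2 s ⟨π1 n, ⟨k, u⟩⟩) (π2 n)).
    split.
    { apply (rec_prec _ (fun w => f1 (π1 w) (π1 (π2 w)))
        (fun w k u => f2 (π1 w) ⟨π1 (π2 w), ⟨k, u⟩⟩)); rec_tac.
      - apply (rec_comp2 _ f1); rec_tac.
      - apply (rec_comp2 _ f2); rec_tac. }
    intros n. rewrite <- (pair_eta n). rewrite pi1_pair, pi2_pair.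
    generalize (π1 n) (π2 n). intros a k.
    (* Inversion cannot see through the pairing function, so the argument is kept as a remembered
       pair and [pair_inj] decodes the resulting equation. *)
    induction k as [|k IH]; intros v E; remember ⟨_, _⟩ as m eqn:En in E;
      inversion E as [| | | | | | | |c1' c2' a' v' E1 Ec Em
      |c1' c2' a' k' u v' E1 E2 Ec Em|]; subst c1' c2' v'; rewrite <- Em in En;
      apply pair_inj in En as [-> En];
      try discriminate.
    + simpl. auto.
    + injection En as ->.
      refine (eventually_mono _ _ _ (eventually_and _ _ (IH _ E1) (L2 _ _ E2))).
      intros s [E1' E2']. cbn [nat_rect]. now rewrite E1'.
  - destruct (rec_least empty_oracle
      (fun w m => m = π1 w \/ f1 (π1 w) ⟨π2 w, m⟩ = 0)) as (g & Hg & Hleast).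
    { rec_tac. apply (rec_comp2 _ f1); rec_tac. }
    { intros z. exists (π1 z). auto. }
    exists (fun s n => g ⟨s, n⟩). split; [unfold computable; rec_tac|].
    intros n v E. inversion E as [| | | | | | | | | |c' a v' w E1 E2]; subst.
    assert (Hlt : eventually (fun s => forall m, m < v -> f1 s ⟨n, m⟩ = S (w m))).
    { apply eventually_forall_lt. auto. }
    (* Past stage [v] the cut-off cannot end the search before [v]. *)
    refine (eventually_mono _ _ _ (eventually_and _ _ Hlt
      (eventually_and _ _ (L1 _ _ E2) (eventually_ge (S v))))).
    intros s (F1 & F2 & F3). destruct (Hleast ⟨s, n⟩) as [G1 G2].
    rewrite pi1_pair, pi2_pair in *.
    destruct (Nat.lt_trichotomy (g ⟨s, n⟩) v) as [Hl|[->|Hl]]; [|reflexivity|].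
    + destruct G1 as [G1|G1]; [lia|]. rewrite F1 in G1 by assumption. discriminate.
    + exfalso. apply (G2 v Hl). auto.
Qed.

(** With the halting problem as [A], this is one half of Shoenfield's limit lemma. *)
Lemma turing_le_approximable A B : turing_le B A -> approximable A -> approximable B.
Proof.
  intros [c Hc] HA. destruct (eval_approximable _ c HA) as (f & Hf & L).
  exists f. split; [exact Hf|]. intros n. apply L.
  destruct (classic (B n)); [rewrite char_true|rewrite char_false]; auto; now apply Hc.
Qed.

(** * Approximating the halting problem *)

Notation "t ∈∈ D" := (Nat.testbit D t = true) (at level 70).

(* A finite set of triples (program number, input, output), given by the binary
   expansion of [D], is a certificate when each of its triples follows from
   others in it by a rule of [eval]. Premises have a smaller program number, or
   the same one and a smaller recursion argument, so certificates are sound. *)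
Definition step (D e q n v : nat) : Prop :=
  (e = 0 /\ v = 0) \/
  (e = 1 /\ v = S n) \/
  (e = 2 /\ v = π1 n) \/
  (e = 3 /\ v = π2 n) \/
  (e = 4 /\ v = 0) \/
  (e = 5 + 4 * q /\ ⟨π1 q, ⟨n, π1 v⟩⟩ ∈∈ D /\ ⟨π2 q, ⟨n, π2 v⟩⟩ ∈∈ D) \/
  (e = 6 + 4 * q /\ exists u, u < D /\ ⟨π2 q, ⟨n, u⟩⟩ ∈∈ D /\ ⟨π1 q, ⟨u, v⟩⟩ ∈∈ D) \/
  (e = 7 + 4 * q /\ π2 n = 0 /\ ⟨π1 q, ⟨π1 n, v⟩⟩ ∈∈ D) \/
  (e = 7 + 4 * q /\ 0 < π2 n /\ exists u, u < D /\
     ⟨e, ⟨⟨π1 n, π2 n - 1⟩, u⟩⟩ ∈∈ D /\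
     ⟨π2 q, ⟨⟨π1 n, ⟨π2 n - 1, u⟩⟩, v⟩⟩ ∈∈ D) \/
  (e = 8 + 4 * q /\ ⟨q, ⟨⟨n, v⟩, 0⟩⟩ ∈∈ D /\
     forall m, m < v -> exists w, w < D /\ ⟨q, ⟨⟨n, m⟩, S w⟩⟩ ∈∈ D).

(** For a compound program number [e], the quotient [(e - 5) / 4] is the code of the components; the
    residue names the constructor. *)
Definition justified (D t : nat) : Prop :=
  step D (π1 t) ((π1 t - 5) / 4) (π1 (π2 t)) (π2 (π2 t)).

Definition certificate (D : nat) : Prop := forall t, t < D -> t ∈∈ D -> justified D t.

(** A set bit at [t] forces [D >= 2^t > t]. Hence bounding the quantifiers in [step] and
    [certificate] by [D] loses nothing, and it makes them decidable. *)
Lemma bit_lt t D : t ∈∈ D -> t < D.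
Proof.
  intros H. destruct (Nat.lt_ge_cases t D) as [|Hle]; [assumption|].
  rewrite Nat.bits_above_log2 in H; [discriminate|].
  destruct D as [|D]; [now rewrite Nat.bits_0 in H|].
  pose proof (Nat.log2_lt_lin (S D)). lia.
Qed.

Lemma triple_bit_lt D e n v : ⟨e, ⟨n, v⟩⟩ ∈∈ D -> v < D.
Proof.
  intros H%bit_lt. pose proof (le_pair e ⟨n, v⟩). pose proof (le_pair n v). lia.
Qed.

(** The residue of [e - 5] modulo 4 selects the constructor and the quotient its components. It lets
    every number in a certificate be read as a program. *)
Lemma code_surj e : exists c, encode c = e.
Proof.
  induction e as [e IH] using (well_founded_induction lt_wf).
  destruct (Nat.lt_ge_cases e 5) as [H|H].
  - destruct e as [|[|[|[|[|e]]]]]; [now exists Zero|now exists Succ|now exists Fst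
      |now exists Snd|now exists Oracle|lia].
  - pose proof (Nat.div_mod_eq (e - 5) 4) as E.
    pose proof (Nat.mod_upper_bound (e - 5) 4) as Hr.
    set (q := (e - 5) / 4) in *. set (r := (e - 5) mod 4) in *.
    assert (Hq : π1 q <= q /\ π2 q <= q).
    { pose proof (le_pair (π1 q) (π2 q)) as L. now rewrite pair_eta in L. }
    destruct (IH (π1 q)) as [c1 H1]; [lia|]. destruct (IH (π2 q)) as [c2 H2]; [lia|].
    destruct (IH q) as [c3 H3]; [lia|].
    assert (Hr' : r = 0 \/ r = 1 \/ r = 2 \/ r = 3) by lia.
    destruct Hr' as [Hr'|[Hr'|[Hr'|Hr']]];
      [exists (Pair c1 c2)|exists (Comp c1 c2)|exists (Prec c1 c2)|exists (Mu c3)];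
      cbn [encode]; rewrite ?H1, ?H2, ?H3, ?pair_eta; lia.
Qed.

Lemma justified_triple D e n v : justified D ⟨e, ⟨n, v⟩⟩ = step D e ((e - 5) / 4) n v.
Proof. unfold justified. now rewrite !pi2_pair, !pi1_pair. Qed.

Lemma certificate_sound D c n v :
  certificate D -> ⟨encode c, ⟨n, v⟩⟩ ∈∈ D -> eval empty_oracle c n v.
Proof.
  intros HD. revert n v.
  assert (Hs : forall c n v, ⟨encode c, ⟨n, v⟩⟩ ∈∈ D ->
    step D (encode c) ((encode c - 5) / 4) n v).
  { intros c' n v H. rewrite <- justified_triple. apply HD; [|exact H]. now apply bit_lt. }
  assert (Hq : forall r q, r < 4 -> (5 + r + 4 * q - 5) / 4 = q).
  { intros r q Hr. symmetry. apply Nat.div_unique with r; lia. }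
  induction c as [| | | | |c1 IH1 c2 IH2|c1 IH1 c2 IH2|c1 IH1 c2 IH2|c1 IH1];
    intros n v H; specialize (Hs _ _ _ H).
  - cbn in Hs. replace v with 0 by (unfold step in Hs; intuition lia). constructor.
  - cbn in Hs. replace v with (S n) by (unfold step in Hs; intuition lia). constructor.
  - cbn in Hs. replace v with (π1 n) by (unfold step in Hs; intuition lia).
    rewrite <- (pair_eta n) at 1. constructor.
  - cbn in Hs. replace v with (π2 n) by (unfold step in Hs; intuition lia).
    rewrite <- (pair_eta n) at 1. constructor.
  - cbn in Hs. replace v with 0 by (unfold step in Hs; intuition lia).
    apply eval_Oracle_out. intros [].
  - cbn [encode] in *. rewrite (Hq 0) in Hs by lia.
    set (q := ⟨encode c1, encode c2⟩) in *.
    assert (Hs' : ⟨π1 q, ⟨n, π1 v⟩⟩ ∈∈ D /\ ⟨π2 q, ⟨n, π2 v⟩⟩ ∈∈ D).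
    { unfold step in Hs. intuition lia. }
    subst q. rewrite pi1_pair, pi2_pair in Hs'.
    rewrite <- (pair_eta v). constructor; [apply IH1|apply IH2]; tauto.
  - cbn [encode] in *. rewrite (Hq 1) in Hs by lia.
    set (q := ⟨encode c1, encode c2⟩) in *.
    assert (Hs' : exists u, u < D /\ ⟨π2 q, ⟨n, u⟩⟩ ∈∈ D /\ ⟨π1 q, ⟨u, v⟩⟩ ∈∈ D).
    { unfold step in Hs. intuition lia. }
    subst q. rewrite pi1_pair, pi2_pair in Hs'. destruct Hs' as (u & _ & Hu & Hv).
    apply eval_Comp with u; auto.
  (* One premise has the same program number, so an inner induction on the recursion argument is
     required. *)
  - revert v H Hs. rewrite <- (pair_eta n). generalize (π1 n) (π2 n). clear n.
    intros a k. induction k as [|k IH]; intros v H Hs; cbn [encode] in *;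
      rewrite (Hq 2) in Hs by lia; set (q := ⟨encode c1, encode c2⟩) in *.
    + assert (Hs' : ⟨π1 q, ⟨a, v⟩⟩ ∈∈ D).
      { unfold step in Hs. rewrite pi1_pair, pi2_pair in Hs. intuition lia. }
      subst q. rewrite pi1_pair in Hs'. constructor. auto.
    + assert (Hs' : exists u, u < D /\ ⟨7 + 4 * q, ⟨⟨a, k⟩, u⟩⟩ ∈∈ D /\
        ⟨π2 q, ⟨⟨a, ⟨k, u⟩⟩, v⟩⟩ ∈∈ D).
      { unfold step in Hs. rewrite pi1_pair, pi2_pair in Hs.
        replace (S k - 1) with k in Hs by lia. intuition lia. }
      subst q. rewrite pi2_pair in Hs'. destruct Hs' as (u & _ & Hu & Hv).
      apply eval_Prec_S with u; [|auto]. apply IH; [exact Hu|].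
      rewrite <- justified_triple. apply HD; [|exact Hu]. now apply bit_lt.
  - cbn [encode] in *. rewrite (Hq 3) in Hs by lia. set (q := encode c1) in *.
    assert (Hs' : ⟨q, ⟨⟨n, v⟩, 0⟩⟩ ∈∈ D /\
      forall m, m < v -> exists w, w < D /\ ⟨q, ⟨⟨n, m⟩, S w⟩⟩ ∈∈ D).
    { unfold step in Hs. intuition lia. }
    destruct Hs' as [H0 Hm].
    (* [eval_Mu] takes the nonzero outputs as a function, so they are chosen by [epsilon]. *)
    set (w := fun m => epsilon (inhabits 0) (fun w => ⟨q, ⟨⟨n, m⟩, S w⟩⟩ ∈∈ D)).
    apply eval_Mu with w; [|auto].
    intros m Hmv. apply IH1. unfold w. apply epsilon_spec.
    destruct (Hm m Hmv) as (u & _ & Hu). now exists u.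
Qed.

Definition subset (D D' : nat) : Prop := forall t, t ∈∈ D -> t ∈∈ D'.

(** [step] is positive in [D], and the bounds on its witnesses are recovered from the triples in
    which they occur. *)
Lemma justified_mono D D' t : subset D D' -> justified D t -> justified D' t.
Proof.
  unfold justified, step. intros HS.
  generalize ((π1 t - 5) / 4) (π1 t) (π1 (π2 t)) (π2 (π2 t)). intros q e n v.
  intros [H|[H|[H|[H|[H|[H|[H|[H|[H|H]]]]]]]]]; auto 12.
  - do 5 right. left. intuition.
  - destruct H as (He & u & Hu & H1 & H2). do 6 right. left. split; [auto|].
    exists u. repeat split; auto. eapply triple_bit_lt; eauto.
  - do 7 right. left. intuition.
  - destruct H as (He & Hn & u & Hu & H1 & H2). do 8 right. left. repeat split; auto.
    exists u. repeat split; auto. eapply triple_bit_lt; eauto.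
  - destruct H as (He & H1 & H2). do 9 right. repeat split; auto.
    intros m Hm. destruct (H2 m Hm) as (w & _ & Hw). exists w. split; [|auto].
    apply HS, triple_bit_lt in Hw. lia.
Qed.

(** [Nat.lor] is the union of finite sets given by binary expansions. *)
Lemma subset_lor_l D D' : subset D (Nat.lor D D').
Proof. intros t H. rewrite Nat.lor_spec, H. reflexivity. Qed.

Lemma subset_lor_r D D' : subset D' (Nat.lor D D').
Proof. intros t H. rewrite Nat.lor_spec, H. apply Bool.orb_true_r. Qed.

Lemma certificate_lor D D' :
  certificate D -> certificate D' -> certificate (Nat.lor D D').
Proof.
  intros H H' t _ Ht. rewrite Nat.lor_spec in Ht.
  apply Bool.orb_true_iff in Ht as [Ht|Ht].
  - apply justified_mono with D; [apply subset_lor_l|]. apply H; [now apply bit_lt|auto].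
  - apply justified_mono with D'; [apply subset_lor_r|]. apply H'; [now apply bit_lt|auto].
Qed.

Lemma certificate_add D t :
  certificate D -> justified D t -> exists D', certificate D' /\ t ∈∈ D'.
Proof.
  intros HD Ht. exists (Nat.lor D (2 ^ t)).
  assert (E : t ∈∈ 2 ^ t) by apply Nat.pow2_bits_true.
  split; [|now apply subset_lor_r].
  intros t' _ Ht'. apply justified_mono with D; [apply subset_lor_l|].
  rewrite Nat.lor_spec in Ht'. apply Bool.orb_true_iff in Ht' as [Ht'|Ht'].
  - apply HD; [now apply bit_lt|auto].
  - rewrite Nat.pow2_bits_eqb in Ht'. apply Nat.eqb_eq in Ht' as <-. exact Ht.
Qed.

(** By induction on the derivation: the certificates of the premises are united and the conclusion
    is added. *)
Lemma certificate_complete c n v :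
  eval empty_oracle c n v -> exists D, certificate D /\ ⟨encode c, ⟨n, v⟩⟩ ∈∈ D.
Proof.
  assert (Hq : forall r q, r < 4 -> (5 + r + 4 * q - 5) / 4 = q).
  { intros r q Hr. symmetry. apply Nat.div_unique with r; lia. }
  assert (H0 : certificate 0) by (intros t Ht; lia).
  induction 1 as [n|n|a b|a b|n H|n H|c1 c2 n v1 v2 _ (D1 & C1 & M1) _ (D2 & C2 & M2)
    |c1 c2 n u v _ (D1 & C1 & M1) _ (D2 & C2 & M2)|c1 c2 a v _ (D1 & C1 & M1)
    |c1 c2 a k u v _ (D1 & C1 & M1) _ (D2 & C2 & M2)|c a n w _ IH _ (D1 & C1 & M1)].
  - apply certificate_add with 0; auto. rewrite justified_triple. left. auto.
  - apply certificate_add with 0; auto. rewrite justified_triple.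
    do 1 right. left. auto.
  - apply certificate_add with 0; auto. rewrite justified_triple.
    do 2 right. left. now rewrite pi1_pair.
  - apply certificate_add with 0; auto. rewrite justified_triple.
    do 3 right. left. now rewrite pi2_pair.
  - destruct H.
  - apply certificate_add with 0; auto. rewrite justified_triple.
    do 4 right. left. auto.
  - apply certificate_add with (Nat.lor D1 D2); [now apply certificate_lor|].
    rewrite justified_triple. cbn [encode]. rewrite (Hq 0) by lia.
    do 5 right. left. rewrite !pi1_pair, !pi2_pair.
    split; [reflexivity|]. split; [now apply subset_lor_l|now apply subset_lor_r].
  - apply certificate_add with (Nat.lor D1 D2); [now apply certificate_lor|].
    apply (subset_lor_l D1 D2) in M1. apply (subset_lor_r D1 D2) in M2.
    rewrite justified_triple. cbn [encode]. rewrite (Hq 1) by lia.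
    do 6 right. left. rewrite !pi1_pair, !pi2_pair.
    split; [reflexivity|]. exists u. split; [|auto]. eapply triple_bit_lt; eauto.
  - apply certificate_add with D1; [assumption|].
    rewrite justified_triple. cbn [encode]. rewrite (Hq 2) by lia.
    do 7 right. left. rewrite !pi1_pair, !pi2_pair. auto.
  - apply certificate_add with (Nat.lor D1 D2); [now apply certificate_lor|].
    apply (subset_lor_l D1 D2) in M1. apply (subset_lor_r D1 D2) in M2.
    rewrite justified_triple. cbn [encode] in *. rewrite (Hq 2) by lia.
    do 8 right. left. rewrite !pi1_pair, !pi2_pair.
    replace (S k - 1) with k by lia.
    split; [reflexivity|]. split; [lia|]. exists u.
    split; [|auto]. eapply triple_bit_lt; eauto.
  (* The rule for [Mu] has one premise for each [m < n]; their certificates are united one by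
     one. *)
  - assert (HD : exists D, certificate D /\
      forall m, m < n -> ⟨encode c, ⟨⟨a, m⟩, S (w m)⟩⟩ ∈∈ D).
    { clear D1 C1 M1. revert IH. generalize n. intros k.
      induction k as [|k IHk]; intros IH.
      - exists 0. split; [assumption|]. intros m Hm. lia.
      - destruct IHk as (D1 & C1 & M1); [auto|].
        destruct (IH k) as (D2 & C2 & M2); [lia|].
        exists (Nat.lor D1 D2). split; [now apply certificate_lor|].
        intros m Hm. destruct (Nat.eq_dec m k) as [->|].
        + now apply subset_lor_r.
        + apply subset_lor_l, M1. lia. }
    destruct HD as (D2 & C2 & M2).
    apply certificate_add with (Nat.lor D1 D2); [now apply certificate_lor|].
    apply (subset_lor_l D1 D2) in M1.
    rewrite justified_triple. cbn [encode] in *. rewrite (Hq 3) by lia.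
    do 9 right. split; [reflexivity|]. split; [assumption|].
    intros m Hm. exists (w m). apply M2, (subset_lor_r D1 D2) in Hm. split; [|assumption].
    apply triple_bit_lt in Hm. lia.
Qed.

(** Stage [s] answers yes when some certificate below [s] shows an output. Answers only change from
    no to yes, so they converge. *)
Lemma halting_problem_approximable : approximable halting_problem.
Proof.
  set (K := fun s x => exists D, D < s /\ certificate D /\
    exists v, v < D /\ ⟨π1 x, ⟨π2 x, v⟩⟩ ∈∈ D).
  exists (fun s x => char (fun w => K (π1 w) (π2 w)) ⟨s, x⟩). split.
  - apply (rec_comp _ (char (fun w => K (π1 w) (π2 w)))); [|rec_tac].
    apply dec_char. unfold K, certificate, justified, step. rec_tac.
  - intros x. destruct (classic (halting_problem x)) as [H|H].
    + rewrite char_true by assumption. destruct H as (c & n & v & -> & E).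
      apply certificate_complete in E as (D & C & M). exists (S D). intros s Hs.
      apply char_true. rewrite pi1_pair, pi2_pair. exists D.
      split; [lia|]. split; [assumption|]. exists v. rewrite pi1_pair, pi2_pair.
      split; [eapply triple_bit_lt; eauto|assumption].
    + rewrite char_false by assumption. exists 0. intros s _.
      apply char_false. rewrite pi1_pair, pi2_pair. intros (D & _ & C & v & _ & M).
      apply H. destruct (code_surj (π1 x)) as [c Hc]. exists c, (π2 x), v.
      rewrite Hc, pair_eta. split; [reflexivity|]. rewrite <- Hc in M.
      now apply certificate_sound with D.
Qed.

(** * The halting problem decides projections of computable relations *)

Lemma encode_inj c c' : encode c = encode c' -> c = c'.
Proof.
  revert c'. induction c; intros c'; destruct c'; cbn [encode]; intros E;
    try reflexivity; try (exfalso; lia).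
  all: try (assert (E' : ⟨encode c1, encode c2⟩ = ⟨encode c'1, encode c'2⟩) by lia;
    apply pair_inj in E' as [E1 E2]; f_equal; auto).
  f_equal. apply IHc. lia.
Qed.

(** Both values are limits of the same approximation supplied by [eval_approximable]. *)
Lemma eval_empty_functional c n v v' :
  eval empty_oracle c n v -> eval empty_oracle c n v' -> v = v'.
Proof.
  intros H H'.
  assert (HE : approximable empty_oracle).
  { exists (fun _ _ => 0). split; [unfold computable; rec_tac|].
    intros m. exists 0. intros. symmetry. apply char_false. intros []. }
  destruct (eval_approximable _ c HE) as (f & _ & L).
  destruct (eventually_and _ _ (L _ _ H) (L _ _ H')) as [s Hs].
  destruct (Hs s) as [<- <-]; auto.
Qed.

(** A witness exists exactly when the unbounded search for it halts, and this is a single query to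
    the oracle. *)
Lemma projection_le_halting_problem (P : nat -> nat -> Prop) :
  turing_le (fun w => P (π1 w) (π2 w)) empty_oracle ->
  turing_le (fun z => exists i, P z i) halting_problem.
Proof.
  intros H. apply dec_not in H. destruct H as [c Hc].
  apply dec_iff with (fun z => halting_problem ⟨encode (Mu c), z⟩).
  - intros z. split.
    + intros (c' & n & v & E & Hv). apply pair_inj in E as [E ->].
      apply encode_inj in E as <-. exists v.
      inversion Hv as [| | | | | | | | | |c' a v' w _ H0]; subst.
      apply NNPP. intros N.
      enough (0 = 1) by discriminate. apply (eval_empty_functional _ _ _ _ H0).
      apply Hc. now rewrite pi1_pair, pi2_pair.
    + intros Hex.
      destruct (dec_inh_nat_subset_has_unique_least_element (P z)) as [i [[Hi Hle] _]];
        [intros; apply classic|assumption|].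
      exists (Mu c), z, i. split; [reflexivity|]. apply eval_Mu with (w := fun _ => 0).
      * intros m Hm. apply Hc. rewrite pi1_pair, pi2_pair.
        intros Hp. apply Hle in Hp. lia.
      * apply Hc. rewrite pi1_pair, pi2_pair. tauto.
  - apply dec_oracle. rec_tac.
Qed.

Lemma turing_equiv_refl A : turing_equiv A A.
Proof. split; apply (dec_oracle A (fun z => z)), rec_id. Qed.

(** * Finite sets of words *)

Lemma Finite_sub_list {U} (l : list U) (T : U -> Prop) :
  (forall x, T x -> List.In x l) -> Finite U T.
Proof.
  assert (ext : forall X Y : U -> Prop, (forall x, X x <-> Y x) -> X = Y).
  { intros X Y H. apply functional_extensionality. intros x.
    apply propositional_extensionality, H. }
  revert T. induction l as [|y l IH]; intros T HT.
  - replace T with (Empty_set U); [constructor|].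
    apply ext. intros x. split; [intros []|intros []%HT].
  - assert (HF : Finite U (fun x => T x /\ x <> y)).
    { apply IH. intros x [[->|Hx]%HT Hxy]; [now destruct Hxy|exact Hx]. }
    destruct (classic (T y)) as [Hy|Hy].
    + replace T with (Add U (fun x => T x /\ x <> y) y).
      { apply Union_is_finite; [exact HF|]. now intros [_ N]. }
      apply ext. intros x. split.
      * intros [x' [Hx _]|x' []]; assumption.
      * intros Hx. destruct (classic (x = y)) as [->|N];
          [right; constructor|now left].
    + replace T with (fun x => T x /\ x <> y); [exact HF|].
      apply ext. intros x. split; [tauto|].
      intros Hx. split; [exact Hx|]. now intros ->.
Qed.

(** There are only finitely many words of each length. Thus an infinite tree has nodes of unbounded
    length. *)
Lemma Finite_words_iff (T : list bool -> Prop) :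
  Finite _ T <-> exists n, forall s, T s -> length s < n.
Proof.
  split.
  - induction 1 as [|X HX [n Hn] s _].
    + exists 0. intros s [].
    + exists (S (n + length s)). intros t [t' Ht|t' Ht].
      * specialize (Hn _ Ht). lia.
      * destruct Ht. lia.
  - intros [n Hn].
    assert (HW : exists l, forall s : list bool, length s < n -> List.In s l).
    { clear. induction n as [|n [l IH]]; [exists []; lia|].
      exists ([] :: map (cons true) l ++ map (cons false) l).
      intros [|[] s] Hs; [now left|right|right]; apply in_app_iff;
        [left|right]; apply in_map, IH; simpl in Hs; lia. }
    destruct HW as [l Hl].
    apply (Finite_sub_list l). intros s Hs. apply Hl, Hn, Hs.
Qed.

(** * Rational and real numbers *)

(* The numerator of [q + L] over the denominator of [q], where [c = code_Q q];
   [code_Z] is even on nonnegative integers and odd on negative ones. *)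
Definition shift (L c : nat) : nat :=
  L * π2 c + (1 - π1 c mod 2) * (π1 c / 2) - (π1 c mod 2) * (S (π1 c) / 2).

Lemma rec_shift A L c : computable_in A c -> computable_in A (fun z => shift L (c z)).
Proof. intros Hc. unfold shift. rec_tac. Qed.

Lemma den_pos q : 0 < π2 (code_Q q).
Proof. unfold code_Q. rewrite pi2_pair. lia. Qed.

(** The hypothesis makes the numerator nonnegative, so the subtraction in [shift] is not
    truncated. *)
Lemma shift_code_Q L q : (- INR L <= Q2R q)%R ->
  INR (shift L (code_Q q)) = ((Q2R q + INR L) * INR (π2 (code_Q q)))%R.
Proof.
  destruct q as [z d]. unfold shift, code_Q, Q2R. cbn [Qnum Qden].
  rewrite pi1_pair, pi2_pair. intros H.
  assert (Hd : IZR (Z.pos d) = INR (Pos.to_nat d)).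
  { now rewrite INR_IZR_INZ, positive_nat_Z. }
  rewrite Hd in *. set (D := Pos.to_nat d) in *.
  assert (HD : (0 < INR D)%R) by (apply lt_0_INR; lia).
  destruct z as [|p|p]; cbn [code_Z].
  - cbn. rewrite Nat.sub_0_r, Nat.add_0_r, mult_INR. lra.
  - assert (Hp : IZR (Z.pos p) = INR (Pos.to_nat p)).
    { now rewrite INR_IZR_INZ, positive_nat_Z. }
    rewrite Hp in *. set (P := Pos.to_nat p) in *.
    replace ((2 * P) mod 2) with 0 by (symmetry; rewrite Nat.mul_comm; apply Nat.Div0.mod_mul).
    replace ((2 * P) / 2) with P by (symmetry; rewrite Nat.mul_comm; now apply Nat.div_mul).
    replace (L * D + (1 - 0) * P - 0 * (S (2 * P) / 2)) with (L * D + P) by lia.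
    rewrite plus_INR, mult_INR. field. lra.
  - assert (Hp : IZR (Z.neg p) = (- INR (Pos.to_nat p))%R).
    { rewrite INR_IZR_INZ, positive_nat_Z. now rewrite <- opp_IZR. }
    assert (HP0 : 0 < Pos.to_nat p) by lia.
    rewrite Hp in *. set (P := Pos.to_nat p) in *.
    replace ((2 * P - 1) mod 2) with 1 by (apply (Nat.mod_unique _ _ (P - 1)); lia).
    replace (S (2 * P - 1) / 2) with P by (apply (Nat.div_unique _ _ P 0); lia).
    replace (L * D + (1 - 1) * ((2 * P - 1) / 2) - 1 * P) with (L * D - P) by lia.
    assert (HPL : (INR P <= INR (L * D))%R).
    { rewrite mult_INR. apply Rmult_le_compat_r with (r := INR D) in H; [|lra].
      replace (- INR P * / INR D * INR D)%R with (- INR P)%R in H by (field; lra). lra. }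
    apply INR_le in HPL. rewrite minus_INR, mult_INR by assumption. field. lra.
Qed.

Definition ratio (a b m : nat) : Q := (Z.of_nat a - Z.of_nat b) # Pos.of_nat m.

(** At most one of the two truncated differences is nonzero; the final [- 1] produces the odd codes
    of negative integers. *)
Lemma code_ratio a b m :
  0 < m -> code_Q (ratio a b m) = ⟨2 * (a - b) + (2 * (b - a) - 1), m⟩.
Proof.
  intros Hm. unfold code_Q, ratio. cbn [Qnum Qden]. f_equal. f_equal.
  - destruct (Z.of_nat a - Z.of_nat b)%Z eqn:E; cbn [code_Z]; lia.
  - apply Nat2Pos.id. lia.
Qed.

Lemma Q2R_ratio a b m : 0 < m -> Q2R (ratio a b m) = ((INR a - INR b) / INR m)%R.
Proof.
  intros Hm. unfold Q2R, ratio. cbn [Qnum Qden].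
  rewrite minus_IZR, <- !INR_IZR_INZ, <- positive_nat_Z, <- INR_IZR_INZ.
  rewrite Nat2Pos.id by lia. reflexivity.
Qed.

Lemma Rabs_le_bounds r b : (Rabs r <= b -> - b <= r <= b)%R.
Proof. unfold Rabs. destruct (Rcase_abs r); lra. Qed.

Lemma half_pow n : ((/ 2) ^ n = / INR (2 ^ n))%R.
Proof. rewrite pow_INR, pow_inv. reflexivity. Qed.

Lemma accumulation_point_intro x a :
  (forall eps n, (0 < eps)%R -> exists i, n <= i /\ (Rabs (x i - a) < eps)%R) ->
  accumulation_point x a.
Proof.
  intros H.
  assert (P : forall n, exists i, n <= i /\ (Rabs (x i - a) < / INR (S n))%R).
  { intros n. apply H. apply Rinv_0_lt_compat, lt_0_INR. lia. }
  apply choice in P as [pick P].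
  (* Each index is picked beyond the previous one, and its precision improves with that bound. *)
  set (phi := nat_rect (fun _ => nat) (pick 0) (fun _ u => pick (S u))).
  assert (Hmono : forall n, phi n < phi (S n)).
  { intros n. exact (proj1 (P (S (phi n)))). }
  assert (Hge : forall n, n <= phi n).
  { induction n as [|n IH]; [lia|]. specialize (Hmono n). lia. }
  assert (Hphi : forall n, (Rabs (x (phi n) - a) < / INR (S n))%R).
  { intros [|n]; [apply (P 0)|].
    apply Rlt_le_trans with (1 := proj2 (P (S (phi n)))).
    apply Rinv_le_contravar; [apply lt_0_INR; lia|]. apply le_INR.
    specialize (Hge n). lia. }
  exists phi. split.
  - intros m n Hmn. induction Hmn as [|n _ IH]; [apply Hmono|].
    specialize (Hmono n). lia.
  - intros eps Heps. destruct (archimed_cor1 eps Heps) as (N & HN & HN0).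
    exists N. intros n Hn. apply Rlt_trans with (2 := HN).
    apply Rlt_le_trans with (1 := Hphi n).
    apply Rinv_le_contravar; [now apply lt_0_INR|]. apply le_INR. lia.
Qed.

(** * Degrees above the jump compute accumulation points *)

Definition value (p : nat -> bool) (n : nat) : nat := digits 2 (fun k => Nat.b2n (p k)) n.

Lemma b2n_le_1 b : Nat.b2n b <= 1.
Proof. destruct b; simpl; lia. Qed.

Lemma value_add p m n :
  value p m * 2 ^ n <= value p (m + n) /\ value p (m + n) < S (value p m) * 2 ^ n.
Proof.
  split; [apply digits_lower|].
  pose proof (digits_upper 1 (fun k => Nat.b2n (p k)) m n (fun k => b2n_le_1 _)) as H.
  unfold value. lia.
Qed.

Lemma value_crossed p m n : value p m * 2 ^ n <= S (value p n) * 2 ^ m.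
Proof.
  destruct (Nat.le_ge_cases m n) as [H|H].
  - replace n with (m + (n - m)) by lia. generalize (n - m). intros j.
    destruct (value_add p m j) as [H1 _]. rewrite Nat.pow_add_r. nia.
  - replace m with (n + (m - n)) by lia. generalize (m - n). intros j.
    destruct (value_add p n j) as [_ H1]. rewrite Nat.pow_add_r. nia.
Qed.

(** The real with binary expansion [p] is the supremum of the left ends; [value_crossed] puts each
    of them below every right end. *)
Lemma value_limit p : exists l, forall n,
  (INR (value p n) / INR (2 ^ n) <= l <= (INR (value p n) + 1) / INR (2 ^ n))%R.
Proof.
  assert (Hpos : forall n, (0 < INR (2 ^ n))%R).
  { intros n. apply lt_0_INR. pose proof (Nat.pow_nonzero 2 n). lia. }
  assert (Hc : forall m n,
    (INR (value p m) / INR (2 ^ m) <= (INR (value p n) + 1) / INR (2 ^ n))%R).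
  { intros m n. pose proof (Hpos m) as Hm. pose proof (Hpos n) as Hn.
    pose proof (le_INR _ _ (value_crossed p m n)) as H.
    rewrite !mult_INR, S_INR in H.
    apply Rmult_le_reg_r with (INR (2 ^ m) * INR (2 ^ n))%R; [nra|].
    field_simplify; lra. }
  destruct (completeness (fun r => exists n, r = INR (value p n) / INR (2 ^ n))%R)
    as [l [Hub Hl]].
  - exists ((INR (value p 0) + 1) / INR (2 ^ 0))%R. intros r [n ->]. apply Hc.
  - eexists. now exists 0.
  - exists l. intros n. split.
    + apply Hub. now exists n.
    + apply Hl. intros r [m ->]. apply Hc.
Qed.

(** For [w > 0], membership of [u / w] in the closed interval from [N / 2^n] to [(N + 1) / 2^n],
    cleared of denominators to be decidable. *)
Definition in_dyadic (N n u w : nat) : Prop := N * w <= 2 ^ n * u /\ 2 ^ n * u <= S N * w.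

Lemma in_dyadic_exists u w n : u <= w -> exists p, in_dyadic (value p n) n u w.
Proof.
  intros Huw. induction n as [|n [p IH]].
  - exists (fun _ => false). split; cbn; lia.
  - assert (HS : forall b, value (fun k => if k =? n then b else p k) (S n) =
      2 * value p n + Nat.b2n b).
    { intros b. unfold value at 1. rewrite digits_S, Nat.eqb_refl. f_equal. f_equal.
      apply digits_ext. intros k Hk.
      destruct (Nat.eqb_spec k n); [lia|reflexivity]. }
    destruct IH as [H1 H2].
    (* Bisection: the next digit records the side of the midpoint on which [u / w] lies. *)
    destruct (Nat.le_gt_cases (2 ^ S n * u) (S (2 * value p n) * w)) as [H|H].
    + exists (fun k => if k =? n then false else p k). unfold in_dyadic.
      rewrite HS, Nat.pow_succ_r' in *. cbn [Nat.b2n]. nia.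
    + exists (fun k => if k =? n then true else p k). unfold in_dyadic.
      rewrite HS, Nat.pow_succ_r' in *. cbn [Nat.b2n]. nia.
Qed.

Lemma in_dyadic_prefix p m n u w :
  in_dyadic (value p (m + n)) (m + n) u w -> in_dyadic (value p m) m u w.
Proof.
  unfold in_dyadic. rewrite Nat.pow_add_r. intros [H1 H2].
  destruct (value_add p m n) as [H3 H4].
  pose proof (Nat.pow_nonzero 2 n ltac:(lia)) as Hn.
  split; apply Nat.mul_le_mono_pos_r with (2 ^ n); nia.
Qed.

Lemma in_dyadic_real N n u w : 0 < w -> in_dyadic N n u w ->
  (INR N / INR (2 ^ n) <= INR u / INR w <= (INR N + 1) / INR (2 ^ n))%R.
Proof.
  intros Hw [H1 H2]. apply le_INR in H1, H2.
  rewrite !mult_INR in H1, H2. rewrite S_INR in H2.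
  assert (H0 : (0 < INR (2 ^ n))%R).
  { apply lt_0_INR. pose proof (Nat.pow_nonzero 2 n). lia. }
  apply lt_INR in Hw. simpl (INR 0) in Hw.
  split; apply Rmult_le_reg_r with (INR (2 ^ n) * INR w)%R; try nra; field_simplify; lra.
Qed.

Lemma degree_gg_computes_accumulation_point (d : degree) (x : nat -> R) :
  degree_gg d zero_jump -> computable_real_sequence x -> bounded_sequence x ->
  exists a : R, accumulation_point x a /\ degree_computes_real d a.
Proof.
  intros Hd (q & Hq & Hqx) [M HM].
  (* The diagonal approximation [q i i] is within [2^-i] of [x i], so it has the same accumulation
     points. *)
  set (c := fun i => code_Q (q i i)).
  assert (Hc : computable c).
  { apply rec_ext with (fun i => let (i, k) := Cantor.of_nat ⟨i, i⟩ in code_Q (q i k)).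
    - intros i. now rewrite Cantor.cancel_of_to.
    - apply (rec_comp _ (fun m => let (i, k) := Cantor.of_nat m in code_Q (q i k)));
        [exact Hq|rec_tac]. }
  clear Hq.
  (* All [q i i] are bounded by [M + 1]. Taking a power of two as the bound makes the final error an
     exact power of one half. *)
  assert (Hm : exists m, (M + 1 <= INR (2 ^ m))%R).
  { destruct (INR_unbounded (M + 1)) as [m Hm]. exists m.
    apply Rlt_le, Rlt_le_trans with (1 := Hm). apply le_INR.
    pose proof (Nat.pow_gt_lin_r 2 m). lia. }
  destruct Hm as [m Hm]. set (L := 2 ^ m) in *.
  assert (HLn : 0 < L) by (apply Nat.neq_0_lt_0, Nat.pow_nonzero; lia).
  assert (HL0 : (0 < INR L)%R) by now apply lt_0_INR.
  assert (Hr : forall i, (- INR L <= Q2R (q i i) <= INR L)%R).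
  { intros i. specialize (Hqx i i). specialize (HM i).
    assert ((/ 2) ^ i <= 1)%R.
    { rewrite half_pow. rewrite <- Rinv_1. apply Rinv_le_contravar; [lra|].
      apply (le_INR 1). pose proof (Nat.pow_nonzero 2 i). lia. }
    apply Rabs_le_bounds in Hqx, HM. lra. }
  (* The fraction [u i / w i] is [q i i] carried from [[-L, L]] to [[0, 1]] by an affine map. *)
  set (u := fun i => shift L (c i)). set (w := fun i => 2 * L * π2 (c i)).
  assert (Hu : computable u) by (apply rec_shift; exact Hc).
  assert (Hw : computable w) by (unfold w, computable; rec_tac).
  assert (Hw0 : forall i, 0 < w i).
  { intros i. unfold w, c. pose proof (den_pos (q i i)). nia. }
  assert (Huw : forall i, (INR (u i) / INR (w i) = (Q2R (q i i) + INR L) / (2 * INR L))%R).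
  { intros i. pose proof (lt_INR _ _ (den_pos (q i i))) as Hden. simpl (INR 0) in Hden.
    unfold u, w, c. rewrite shift_code_Q by apply Hr.
    rewrite !mult_INR. simpl (INR 2). field. lra. }
  assert (Hle : forall i, u i <= w i).
  { intros i. apply INR_le. pose proof (lt_INR _ _ (den_pos (q i i))) as Hden.
    simpl (INR 0) in Hden.
    unfold u, w, c. rewrite shift_code_Q by apply Hr.
    rewrite !mult_INR. simpl (INR 2). specialize (Hr i).
    apply Rmult_le_compat_r; lra. }
  clearbody u w.
  set (C := fun z i => len z <= i /\ in_dyadic (value (bits z) (len z)) (len z) (u i) (w i)).
  assert (HC : turing_le (fun z => exists i, C z i) halting_problem).
  { apply projection_le_halting_problem. unfold C, in_dyadic, len, bits.
    assert (HV : computable_in empty_oracle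
      (fun z => value (Nat.testbit (S (π1 z))) (Nat.log2 (S (π1 z))))).
    { unfold value.
      apply (rec_digits _ 2 (fun z k => Nat.b2n (Nat.testbit (S (π1 z)) k))); rec_tac. }
    rec_tac. }
  assert (HCp : forall p n, (exists i, C (word p n) i) <->
    exists i, n <= i /\ in_dyadic (value p n) n (u i) (w i)).
  { intros p n. unfold C. rewrite len_word.
    replace (value (bits (word p n)) n) with (value p n); [reflexivity|].
    apply digits_ext. intros k Hk. now rewrite bits_word. }
  set (T := fun s => exists i, C (code_word s) i).
  destruct (Hd T) as (p & Hp & A & HA & Hcp).
  - split.
    + intros s t (i & Hi & Hd'). unfold T. exists i. unfold C in *.
      rewrite len_code_word in *. rewrite length_app in *. split; [lia|].
      apply in_dyadic_prefix in Hd'.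
      replace (value (bits (code_word s)) (length s)) with
        (value (bits (code_word (s ++ t))) (length s)); [exact Hd'|].
      apply digits_ext. intros k Hk.
      rewrite !bits_code_word by (rewrite ?length_app; lia). now rewrite app_nth1.
    + exists halting_problem. split.
      * apply turing_equiv_refl.
      * apply dec_iff with (2 := HC). intros z. split.
        -- intros Hz. destruct (code_word_surj z) as [s ->]. now exists s.
        -- intros (s & Hs & ->). exact Hs.
  - intros Hfin. apply Finite_words_iff in Hfin as [n Hn].
    (* The term with index [n] itself gives a node of length [n]. *)
    destruct (in_dyadic_exists (u n) (w n) n (Hle n)) as [p Hp].
    specialize (Hn (map p (seq 0 n))). rewrite length_map, length_seq in Hn.
    enough (n < n) by lia. apply Hn. apply (HCp p n). now exists n.
  - assert (Hpn : forall n, exists i, n <= i /\ in_dyadic (value p n) n (u i) (w i)).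
    { intros n. apply HCp, Hp. }
    destruct (value_limit p) as [l Hl].
    assert (Hpow : forall n, (0 < INR (2 ^ n))%R).
    { intros n. apply lt_0_INR. pose proof (Nat.pow_nonzero 2 n). lia. }
    exists (2 * INR L * l - INR L)%R. split.
    + apply accumulation_point_intro. intros eps n0 Heps.
      (* The distance to the limit is at most [2^-i] from the rational approximation plus
         [2 * L * 2^-n] from the rescaled interval; as [i >= n], the sum is at most
         [(2 * L + 1) * 2^-n]. *)
      destruct (pow_lt_1_zero (/ 2) ltac:(rewrite Rabs_pos_eq; lra)
        (eps / (2 * INR L + 1))%R ltac:(apply Rdiv_lt_0_compat; lra)) as [n1 Hn1].
      set (n := max n0 n1). destruct (Hpn n) as (i & Hi & Hin).
      exists i. split; [lia|].
      specialize (Hn1 n ltac:(lia)).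
      rewrite Rabs_pos_eq in Hn1 by (apply pow_le; lra).
      apply Rmult_lt_compat_r with (r := (2 * INR L + 1)%R) in Hn1; [|lra].
      replace (eps / (2 * INR L + 1) * (2 * INR L + 1))%R with eps in Hn1 by (field; lra).
      specialize (Hqx i i). specialize (Hl n).
      apply in_dyadic_real in Hin; [|apply Hw0]. rewrite Huw in Hin.
      assert (Hpi : ((/ 2) ^ i <= (/ 2) ^ n)%R).
      { rewrite !half_pow. apply Rinv_le_contravar; [apply Hpow|].
        apply le_INR, Nat.pow_le_mono_r; lia. }
      rewrite (half_pow n) in Hn1, Hpi. set (h := (/ INR (2 ^ n))%R) in *.
      set (y := ((Q2R (q i i) + INR L) / (2 * INR L))%R) in *.
      assert (Hy : (Q2R (q i i) = 2 * INR L * y - INR L)%R) by (unfold y; field; lra).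
      assert (Hyl : (- h <= y - l <= h)%R).
      { unfold Rdiv in Hin, Hl. fold h in Hin, Hl. lra. }
      assert (HLy : (2 * INR L * - h <= 2 * INR L * (y - l) <= 2 * INR L * h)%R).
      { split; apply Rmult_le_compat_l; lra. }
      apply Rabs_le_bounds in Hqx. apply Rabs_def1; lra.
    (* The left end of the [n]-th interval is carried back to [[-L, L]]. Since [L = 2^m], the
       rescaled interval has length [2 * L / 2^n = 2^-k]. *)
    + exists (fun k => let n := k + m + 1 in
        ratio (2 * L * value p n) (L * 2 ^ n) (2 ^ n)).
      split.
      * exists A. split; [exact HA|]. cbv zeta.
        apply rec_ext with (fun k => ⟨2 * (2 * L * value p (k + m + 1) - L * 2 ^ (k + m + 1)) +
          (2 * (L * 2 ^ (k + m + 1) - 2 * L * value p (k + m + 1)) - 1), 2 ^ (k + m + 1)⟩).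
        { intros k. rewrite code_ratio; [reflexivity|]. apply INR_lt, Hpow. }
        assert (HV : computable_in A (fun k => value p (k + m + 1))).
        { unfold value. apply (rec_digits _ 2 (fun _ k => Nat.b2n (p k))); rec_tac.
          apply (rec_comp _ (fun k => Nat.b2n (p k))); rec_tac. }
        rec_tac.
      * intros k. cbv zeta. set (n := k + m + 1).
        specialize (Hl n). specialize (Hpow n).
        rewrite Q2R_ratio by apply INR_lt, Hpow. rewrite !mult_INR. change (INR 2) with 2%R.
        assert (HLk : (2 * INR L / INR (2 ^ n) = (/ 2) ^ k)%R).
        { rewrite half_pow. unfold n, L.
          rewrite !Nat.pow_add_r, !mult_INR. simpl (INR (2 ^ 1)).
          rewrite !pow_INR. simpl (INR 2). field. split; apply pow_nonzero; lra. }
        rewrite <- HLk. set (N := INR (2 ^ n)) in *. set (V := INR (value p n)) in *.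
        replace ((2 * INR L * V - INR L * N) / N - (2 * INR L * l - INR L))%R
          with (2 * INR L * (V / N - l))%R by (field; lra).
        change (2 * INR L / N)%R with (2 * INR L * / N)%R.
        assert (Hb : (- / N <= V / N - l <= 0)%R) by (unfold Rdiv in *; lra).
        assert (H0N : (0 < / N)%R) by now apply Rinv_0_lt_compat.
        set (t := (V / N - l)%R) in *. set (h := (/ N)%R) in *. apply Rabs_le. split; nra.
Qed.

(** * Computing branches from accumulation points *)

Definition value4 (w n : nat) : nat := digits 4 (fun k => Nat.b2n (bits w k)) n.

(* The branch coded by a word [w] is read as a base-4 expansion with digits 0 and
   1: then the expansions form a set with gaps, on which the digits are
   continuous functions of the number. *)
Definition cantor (w : nat) : R := (INR (value4 w (len w)) / INR (4 ^ len w))%R.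

Lemma pow4_pos n : (0 < INR (4 ^ n))%R.
Proof. apply lt_0_INR. pose proof (Nat.pow_nonzero 4 n). lia. Qed.

(** Digits after the first [n], scaled by [4^n], add at most [1/4 + 1/16 + ... = 1/3]. The gap below
    the next integer absorbs approximation errors. *)
Lemma cantor_digits w n : n <= len w ->
  (INR (value4 w n) <= cantor w * INR (4 ^ n) <= INR (value4 w n) + / 3)%R.
Proof.
  intros Hn. unfold cantor. replace (len w) with (n + (len w - n)) by lia.
  generalize (len w - n). clear Hn. intros r.
  pose proof (digits_lower 4 (fun k => Nat.b2n (bits w k)) n r) as H1.
  pose proof (digits_upper 3 (fun k => Nat.b2n (bits w k)) n r (fun k => b2n_le_1 _)) as H2.
  fold (value4 w n) (value4 w (n + r)) in H1, H2.
  apply le_INR in H1, H2. rewrite Nat.pow_add_r, mult_INR.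
  rewrite !plus_INR, !mult_INR, !plus_INR, !mult_INR in H2. rewrite mult_INR in H1.
  simpl (INR 3) in H2. simpl (INR 1) in H2.
  pose proof (pow4_pos n) as Hn. pose proof (pow4_pos r) as Hr.
  set (a := INR (4 ^ n)) in *. set (b := INR (4 ^ r)) in *.
  replace (INR (value4 w (n + r)) / (a * b) * a)%R
    with (INR (value4 w (n + r)) / b)%R by (field; lra).
  split; apply Rmult_le_reg_r with b; try assumption; field_simplify; nra.
Qed.

Lemma cantor_bounds w : (0 <= cantor w <= 1)%R.
Proof.
  pose proof (cantor_digits w 0 ltac:(lia)) as H. simpl in H. lra.
Qed.

(** For [c] coding a rational [q >= -1], this is the parity of the integer part of
    [4^(k+1) * (q + 1) + 1/4]. The summand [4^(k+1)] is even, so digit [k] remains. *)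
Definition digit_of_approx (c k : nat) : bool :=
  Nat.testbit ((4 ^ (k + 2) * shift 1 c + π2 c) / (4 * π2 c)) 0.

Lemma rec_digit_of_approx A c n : computable_in A c -> computable_in A n ->
  computable_in A (fun k => Nat.b2n (digit_of_approx (c (n k)) k)).
Proof.
  intros Hc Hn. unfold digit_of_approx.
  assert (Hs : computable_in A (fun k => shift 1 (c (n k)))) by (apply rec_shift; rec_tac).
  rec_tac.
Qed.

(** After scaling by [4^(k+1)], the error [3/16] and the offset [1/4] leave the number between
    [V + 1/16] and [V + 1/3 + 3/16 + 1/4 < V + 1], so its integer part is [V]. *)
Lemma digit_of_approx_correct w q k : k < len w ->
  (Rabs (Q2R q - cantor w) <= 3 / 16 / INR (4 ^ S k))%R ->
  digit_of_approx (code_Q q) k = bits w k.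
Proof.
  intros Hk Hq. pose proof (cantor_digits w (S k) Hk) as HV.
  set (V := value4 w (S k)) in *. pose proof (pow4_pos (S k)) as Hpow.
  assert (H4 : (4 <= INR (4 ^ S k))%R).
  { replace 4%R with (INR 4) by (simpl; lra). apply le_INR.
    rewrite Nat.pow_succ_r'. pose proof (Nat.pow_nonzero 4 k). lia. }
  assert (Hq' : (- (3 / 16) <= Q2R q * INR (4 ^ S k) - cantor w * INR (4 ^ S k) <= 3 / 16)%R).
  { apply Rabs_le_bounds in Hq. rewrite <- Rmult_minus_distr_r.
    replace (3 / 16)%R with (3 / 16 / INR (4 ^ S k) * INR (4 ^ S k))%R by (field; lra).
    rewrite Ropp_mult_distr_l. split; apply Rmult_le_compat_r; lra. }
  assert (HV0 : (0 <= INR V)%R) by apply pos_INR.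
  (* [cantor w] is nonnegative and the error is below 1, so shifting by 1 suffices. *)
  assert (Hq1 : (- INR 1 <= Q2R q)%R).
  { simpl (INR 1). destruct (Rle_lt_dec (-1) (Q2R q)) as [|Hlt]; [assumption|nra]. }
  pose proof (lt_INR _ _ (den_pos q)) as Hd. simpl (INR 0) in Hd.
  unfold digit_of_approx. pose proof (shift_code_Q 1 q Hq1) as Hs.
  set (u := shift 1 (code_Q q)) in *. pose proof (den_pos q) as Hd'.
  set (d := π2 (code_Q q)) in *. simpl (INR 1) in Hs.
  assert (E4 : INR (4 ^ (k + 2)) = (4 * INR (4 ^ S k))%R).
  { replace (k + 2) with (S (S k)) by lia. rewrite (Nat.pow_succ_r' 4 (S k)), mult_INR.
    simpl (INR 4). lra. }
  assert (Hfloor : (4 ^ (k + 2) * u + d) / (4 * d) = V + 4 ^ S k).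
  { symmetry. apply (Nat.div_unique _ _ _ (4 ^ (k + 2) * u + d - (4 * d) * (V + 4 ^ S k))).
    - enough (4 ^ (k + 2) * u + d < 4 * d * (V + 4 ^ S k) + 4 * d) by lia.
      apply INR_lt. rewrite !plus_INR, !mult_INR, plus_INR, E4, Hs. simpl (INR 4). nra.
    - enough (4 * d * (V + 4 ^ S k) <= 4 ^ (k + 2) * u + d) by lia.
      apply INR_le. rewrite !plus_INR, !mult_INR, plus_INR, E4, Hs. simpl (INR 4). nra. }
  rewrite Hfloor. unfold V, value4. rewrite digits_S, Nat.pow_succ_r'.
  set (D := digits _ _ _).
  replace (4 * D + Nat.b2n (bits w k) + 4 * 4 ^ k)
    with (2 * (2 * D + 2 * 4 ^ k) + Nat.b2n (bits w k)) by lia.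
  apply Nat.testbit_0_r.
Qed.

(** The bound [S (len w)] includes [w] itself among the prefixes tested. *)
Definition good (f : nat -> nat -> nat) (s w : nat) : Prop :=
  forall k, k < S (len w) -> f s (word (bits w) k) = 1.

(* [s - j s] is the largest, hence a longest, word up to [s] that looks like a
   node of the tree at stage [s]. *)
Lemma longest_good_word_converges (T : list bool -> Prop) (f : nat -> nat -> nat)
    (j : nat -> nat) :
  is_tree T -> ~ Finite _ T ->
  (forall z, eventually (fun s =>
     f s z = char (fun n => exists t, T t /\ n = code_word t) z)) ->
  (forall s, (j s = s \/ good f s (s - j s)) /\
     forall m, m < j s -> ~ (m = s \/ good f s (s - m))) ->
  forall n, eventually (fun s =>
    n <= len (s - j s) /\ T (map (bits (s - j s)) (seq 0 n))).
Proof.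
  intros T_tree T_infinite f_limit Hj n.
  assert (Ht : exists t, T t /\ length t = n).
  { apply NNPP. intros N. apply T_infinite, Finite_words_iff. exists n. intros s Hs.
    apply Nat.nle_gt. intros Hle. apply N. exists (firstn n s). split.
    - apply T_tree with (skipn n s). now rewrite firstn_skipn.
    - now apply firstn_length_le. }
  destruct Ht as (t & Ht & Hlen). set (v := code_word t).
  (* Words of length at most [n] have codes below [2 ^ S n], so the guesses on all of them are final
     from some stage on. *)
  assert (Hlim : eventually (fun s => forall z, z < 2 ^ S n ->
    f s z = char (fun n => exists t, T t /\ n = code_word t) z)).
  { apply eventually_forall_lt. auto. }
  refine (eventually_mono _ _ _ (eventually_and _ _ Hlim (eventually_ge v))).
  intros s [Hf Hvs]. destruct (Hj s) as [H1 H2].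
  assert (Hw : forall w k, k <= n -> f s (word (bits w) k) = 1 <->
    T (map (bits w) (seq 0 k))).
  { intros w k Hk. rewrite Hf.
    2:{ apply Nat.lt_le_trans with (1 := word_lt _ _). apply Nat.pow_le_mono_r; lia. }
    split.
    - intros E. destruct (classic (exists t, T t /\ word (bits w) k = code_word t))
        as [(t' & Ht' & E')|N].
      + apply code_word_inj in E'. now subst t'.
      + rewrite char_false in E by assumption. discriminate.
    - intros Hk'. apply char_true. now exists (map (bits w) (seq 0 k)). }
  assert (Hv : good f s v).
  { intros k Hk. unfold v in *. rewrite len_code_word in Hk. apply Hw; [lia|].
    apply T_tree with (map (bits (code_word t)) (seq k (length t - k))).
    rewrite <- map_app, <- seq_app. replace (k + (length t - k)) with (length t) by lia.
    now rewrite code_word_bits. }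
  (* Since [v] is good, the downward search stops no later than at [v]; the word found is at least
     [v], hence at least as long. *)
  assert (Hjv : j s <= s - v).
  { apply Nat.nlt_ge. intros Hlt. apply (H2 _ Hlt). right.
    now replace (s - (s - v)) with v by lia. }
  (* If the search ended by the cut-off [j s = s], then [v = 0], which is the word found and is
     good. *)
  assert (Hgood : good f s (s - j s)).
  { destruct H1 as [H1|H1]; [|assumption].
    now replace (s - j s) with v by lia. }
  assert (Hle : n <= len (s - j s)).
  { rewrite <- Hlen, <- len_code_word. apply Nat.log2_le_mono. fold v. lia. }
  split; [exact Hle|]. apply Hw; [lia|]. apply Hgood. lia.
Qed.

Lemma computes_accumulation_points_degree_gg (d : degree) :
  (forall x : nat -> R, computable_real_sequence x -> bounded_sequence x ->
     exists a : R, accumulation_point x a /\ degree_computes_real d a) ->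
  degree_gg d zero_jump.
Proof.
  intros Hacc T [HT (K & HK & HB)] Hinf.
  assert (HBa : approximable (fun n => exists s, T s /\ n = code_word s)).
  { apply (turing_le_approximable _ _ HB), (turing_le_approximable _ _ (proj1 HK)).
    apply halting_problem_approximable. }
  destruct HBa as (f & Hf & Lf).
  destruct (rec_least empty_oracle (fun s m => m = s \/ good f s (s - m)))
    as (j & Hj & Hleast).
  { unfold good, len. rec_tac. apply (rec_comp2 _ f); rec_tac.
    unfold bits.
    apply (rec_word _ (fun z => Nat.testbit (S (π1 (π1 z) - π2 (π1 z))))); rec_tac. }
  { intros s. exists s. now left. }
  pose proof (longest_good_word_converges T f j HT Hinf Lf Hleast) as Hconv.
  set (w := fun s => s - j s) in *.
  assert (Hw : computable w) by (unfold w, computable; rec_tac).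
  destruct (Hacc (fun s => cantor (w s))) as (a & (phi & Hphi & Hcv) & q & (A & HA & Hq) & Hqa).
  (* The terms are rational, so one exact fraction serves for every precision. *)
  - exists (fun i _ => ratio (value4 (w i) (len (w i))) 0 (4 ^ len (w i))). split.
    + apply rec_ext with (fun z => let i := π1 z in
        ⟨2 * (value4 (w i) (len (w i)) - 0) + (2 * (0 - value4 (w i) (len (w i))) - 1),
         4 ^ len (w i)⟩).
      { intros z. destruct (Cantor.of_nat z) as [i k]. simpl fst. cbv zeta.
        rewrite code_ratio; [reflexivity|]. apply INR_lt, pow4_pos. }
      cbv zeta. unfold len.
      assert (HV : computable_in empty_oracle
        (fun z => value4 (w (π1 z)) (Nat.log2 (S (w (π1 z)))))).
      { unfold value4, bits.
        apply (rec_digits _ 4 (fun z k => Nat.b2n (Nat.testbit (S (w (π1 z))) k))); rec_tac. }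
      rec_tac.
    + intros i k. rewrite Q2R_ratio by apply INR_lt, pow4_pos.
      unfold cantor. simpl (INR 0). rewrite Rminus_0_r, Rminus_diag, Rabs_R0.
      apply pow_le. lra.
  - exists 1%R. intros i. pose proof (cantor_bounds (w i)). apply Rabs_le. lra.
  (* Accuracy [2^-(2k+5)] is [1/8] of [4^-(k+1)]. Closeness of the subsequence to [a] costs another
     [1/16], and the total [3/16] is what [digit_of_approx_correct] allows. *)
  - exists (fun k => digit_of_approx (code_Q (q (2 * k + 5))) k). split.
    + intros n. destruct (Hconv n) as [s0 Hs0].
      destruct (Hcv (/ INR (4 ^ (n + 2)))%R) as [n1 Hn1].
      { apply Rinv_0_lt_compat, pow4_pos. }
      (* For each [n], some term close to [a] comes from a word whose first [n] letters form a node;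
         the digits computed from [a] are these letters. *)
      set (i := max s0 n1).
      assert (Hi : i <= phi i).
      { generalize i. intros k. induction k as [|k IH]; [lia|].
        specialize (Hphi k (S k)). lia. }
      destruct (Hs0 (phi i)) as [Hlen HTn]; [lia|].
      specialize (Hn1 i ltac:(lia)). unfold Rdist in Hn1.
      fold (w (phi i)) in Hlen, HTn.
      erewrite map_ext_in; [exact HTn|].
      intros k Hk. apply in_seq in Hk. apply digit_of_approx_correct; [lia|].
      specialize (Hqa (2 * k + 5)).
      assert (E1 : ((/ 2) ^ (2 * k + 5) = / 8 / INR (4 ^ S k))%R).
      { rewrite half_pow. replace (2 * k + 5) with (2 * S k + 3) by lia.
        rewrite Nat.pow_add_r, Nat.pow_mul_r, mult_INR.
        change (2 ^ 2) with 4. change (2 ^ 3) with 8. pose proof (pow4_pos (S k)).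
        replace (INR 8) with 8%R by (simpl; lra). field. lra. }
      assert (E2 : (/ INR (4 ^ (n + 2)) <= / 16 / INR (4 ^ S k))%R).
      { pose proof (pow4_pos (S k)).
        replace (/ 16 / INR (4 ^ S k))%R with (/ (INR (4 ^ S k) * 16))%R by (field; lra).
        apply Rinv_le_contravar; [lra|].
        replace 16%R with (INR 16) by (simpl; lra). rewrite <- mult_INR. apply le_INR.
        change 16 with (4 ^ 2). rewrite <- Nat.pow_add_r. apply Nat.pow_le_mono_r; lia. }
      rewrite E1 in Hqa. apply Rabs_le_bounds in Hqa. apply Rabs_def2 in Hn1.
      apply Rabs_le. unfold Rdiv in *. lra.
    + exists A. split; [exact HA|].
      apply (rec_digit_of_approx A _ (fun k => 2 * k + 5)) in Hq; [exact Hq|rec_tac].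
Qed.

Theorem mainTheorem2 (d : degree) :
  degree_gg d zero_jump <->
  (forall x : nat -> R,
     computable_real_sequence x -> bounded_sequence x ->
     exists a : R, accumulation_point x a /\ degree_computes_real d a).
Proof.
  split.
  - intros Hd x. now apply degree_gg_computes_accumulation_point.
  - apply computes_accumulation_points_degree_gg.
Qed.
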